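(* Let $X(t)$, $t\ge 0$, be the on-off process with on-state $0$ and two off-states $1,2$ constructed in the context, and let $S(t)=\int_0^t 1_{\{X(s)=1\}}\,ds$ be its occupation time in state $1$. Let $t\geq 0$ and $0<s<t$. Then \begin{align*} \Pr(S(t)=0,X(t)=0)&=\sum_{n=0}^\infty\left[F_U^{(n)}*F_L^{(n)}(t)-F_U^{(n+1)}*F_L^{(n)}(t)\right]p_2^n,\\ \Pr(S(t)=0,X(t)=1)&=0,\\ \Pr(S(t)=0,X(t)=2)&=\sum_{n=0}^\infty\left[F_U^{(n+1)}*F_L^{(n)}(t)-F_U^{(n+1)}*F_L^{(n+1)}(t)\right]p_2^{n+1}, \end{align*} and the defective densities $p_{Sj}(s,t)=\Pr(S(t)\in ds,\,X(t)=j)/ds$, $j=0,1,2$, are given by \begin{align*} p_{S0}(s, t)&=\sum_{n=1}^\infty\sum_{k=1}^n\binom{n}{k}p_1^kp_2^{n-k}f_S^{(k)}(s)\left[F_U^{(n)}*F_L^{(n-k)}(t-s)-F_U^{(n+1)}*F_L^{(n-k)}(t-s)\right],\\ p_{S1}(s, t)&=\sum_{n=0}^\infty\sum_{k=0}^n \binom{n}{k}p_1^{k+1}p_2^{n-k}\,f_U^{(n+1)}*f_L^{(n-k)}(t-s)\left[F_S^{(k)}(s)-F_S^{(k+1)}(s)\right],\\ p_{S2}(s, t)&=\sum_{n=1}^\infty\sum_{k=1}^n\binom{n}{k}p_1^kp_2^{n-k+1}f_S^{(k)}(s)\left[F_U^{(n+1)}*F_L^{(n-k)}(t-s)-F_U^{(n+1)}*F_L^{(n-k+1)}(t-s)\right].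 \end{align*}
   Context: **Random inputs.** On a probability space there are given four mutually independent sequences of non-negative random variables: $\{U_k\}_{k\ge1}$ i.i.d. with cdf $F_U$ and pdf $f_U$; $\{S_k\}_{k\ge1}$ i.i.d. with cdf $F_S$ and pdf $f_S$; $\{L_k\}_{k\ge1}$ i.i.d. with cdf $F_L$ and pdf $f_L$ (all three distributions are absolutely continuous); and $\{\xi_k\}_{k\ge1}$ i.i.d. with $\Pr(\xi_k=1)=p_1>0$ and $\Pr(\xi_k=0)=p_2=1-p_1$. **The process.** Set $X(0)=0$, $T_0=0$. For $i=1,2,\ldots$: let $T_{2i-1}=T_{2i-2}+U_i$ and $X(t)=0$ for all $t\in[T_{2i-2},T_{2i-1})$; then, if $\xi_i=1$, let $T_{2i}=T_{2i-1}+S_i$ and $X(t)=1$ for all $t\in[T_{2i-1},T_{2i})$; otherwise let $T_{2i}=T_{2i-1}+L_i$ and $X(t)=2$ for all $t\in[T_{2i-1},T_{2i})$. **Defective densities.** The notation $p_{Sj}(s,t)=\Pr(S(t)\in ds,X(t)=j)/ds$ for $0<s<t$ means that $p_{Sj}(\cdot,t)$ is the Lebesgue density (as usual, determined up to null sets in $s$) of the measure $B\mapsto\Pr(S(t)\in B,\,X(t)=j)$ on Borel sets $B\subset(0,t)$. **Convolution notation.** For cdfs $G,H$ with pdfs $g,h$: $G*H$ is the convolution of the cdfs (the cdf of the sum of two independent random variables with cdfs $G$ and $H$), $g*h$ is the convolution of the pdfs, and $G^{(n)}$, $g^{(n)}$ are the $n$-fold convolutions of $G$ and of $g$ (so $G^{(1)}=G$,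 $g^{(1)}=g$). $G^{(0)}$ is the cdf of the random variable equal to $0$ with probability $1$, and $g^{(k)}*h^{(0)}=g^{(k)}$ for $k\ge1$. Any summation over the empty set is $0$, and $p_2^0=1$. *)

(* Defs.v *)
From HB Require Import structures.
From mathcomp Require Import all_boot all_order all_algebra finmap.
From mathcomp Require Import all_classical all_reals all_analysis.
From mathcomp Require Import measurable_realfun.

Set Implicit Arguments.
Unset Strict Implicit.
Unset Printing Implicit Defensive.

Import Order.TTheory GRing.Theory Num.Theory.
Import numFieldTopology.Exports numFieldNormedType.Exports.

Local Open Scope classical_set_scope.
Local Open Scope ring_scope.

Section independence.
Context {d : measure_display} {T : measurableType d} {R : realType}.
Variable P : probability T R.

Definition mutually_independent (I : choiceType) (G : I -> set (set T)) :=
  forall (J : {fset I}) (A : I -> set T), (forall i, i \in J -> G i (A i)) ->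
  P (\bigcap_(i in [set` J]) A i) = (\prod_(i <- J) P (A i))%E.

Definition sigma_RV (X : {RV P >-> R}) : set (set T) :=
  preimage_set_system setT X measurable.

Definition sigma_seq (X : nat -> {RV P >-> R}) : set (set T) :=
  <<s \bigcup_k sigma_RV (X k) >>.

Definition iid (X : nat -> {RV P >-> R}) :=
  mutually_independent (fun k => sigma_RV (X k)) /\
  forall i j (B : set R), measurable B ->
    distribution P (X i) B = distribution P (X j) B.

Definition has_cdf (X : {RV P >-> R}) (F : R -> R) :=
  forall r, cdf X r = (F r)%:E.

Definition has_pdf (X : {RV P >-> R}) (f : R -> R) :=
  [/\ measurable_fun setT f, (forall x, 0 <= f x) &
    forall B : set R, measurable B ->
      distribution P X B = (\int[lebesgue_measure]_(x in B) (f x)%:E)%E].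

End independence.

Section real_cdf.
Context {d : measure_display} {T : measurableType d} {R : realType}.
Context {P : probability T R}.
Variable X : {RV P >-> R}.

Definition real_cdf (r : R) : R := fine (cdf X r).

Lemma real_cdf_nd : nondecreasing real_cdf.
Proof. by move=> *; rewrite fine_le ?fin_num_measure// cdf_nondecreasing. Qed.

Lemma real_cdf_rc : right_continuous real_cdf.
Proof.
move=> a; apply: fine_cvg.
by rewrite fineK ?fin_num_measure//; exact: cdf_right_continuous.
Qed.

HB.instance Definition _ :=
  isCumulative.Build R _ R real_cdf real_cdf_nd real_cdf_rc.

Lemma real_cdf_Ny : real_cdf @ -oo --> (0 : R).
Proof. exact/fine_cvg/cvg_cdfNy0. Qed.

Lemma real_cdf_y : real_cdf @ +oo --> (1 : R).
Proof. exact/fine_cvg/cvg_cdfy1. Qed.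

HB.instance Definition _ :=
  isCumulativeBounded.Build R 0 1 real_cdf real_cdf_Ny real_cdf_y.

End real_cdf.

(* Cdfs on R are the elements of [cumulativeBounded 0 1]. *)
Section cdf_convolution.
Context {R : realType}.
Implicit Types F G : cumulativeBounded (0 : R) (1 : R).

Definition pair_sum (z : measurableTypeR R * measurableTypeR R) : R :=
  (z.1 : R) + (z.2 : R).

Lemma measurable_pair_sum : measurable_fun setT pair_sum.
Proof.
by apply: measurable_funD; [exact: measurable_fst|exact: measurable_snd].
Qed.

HB.instance Definition _ :=
  isMeasurableFun.Build _ _ _ _ pair_sum measurable_pair_sum.

(* The two coordinates of the product space are independent with cdfs F, G. *)
Definition cdf_conv F G : cumulativeBounded (0 : R) (1 : R) :=
  real_cdf (pair_sum : {RV (lebesgue_stieltjes_measure F \x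
                            lebesgue_stieltjes_measure G)%E >-> R}).

Definition cdf_zero : cumulativeBounded (0 : R) (1 : R) :=
  real_cdf (cst 0 : {RV (\d_(0 : R) : probability R R) >-> R}).

Definition cdf_convn F (n : nat) : cumulativeBounded (0 : R) (1 : R) :=
  if n is m.+1 then iter m (cdf_conv F) F else cdf_zero.

(* F^(n) * G^(m) *)
Definition cdf_conv_pow F n G m := cdf_conv (cdf_convn F n) (cdf_convn G m).

End cdf_convolution.

(* Convolutions of pdfs may be infinite on a null set, hence the values in
   the extended reals. *)
Section pdf_convolution.
Context {R : realType}.

Definition pdf_conv (g h : R -> \bar R) (x : R) : \bar R :=
  (\int[lebesgue_measure]_y (g y * h (x - y)%R))%E.

(* g^(n), meaningful for n >= 1 only: the value at n = 0 is never used. *)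
Definition pdf_convn (g : R -> R) (n : nat) : R -> \bar R :=
  iter n.-1 (pdf_conv (EFin \o g)) (EFin \o g).

(* g^(n) * h^(m) for n >= 1, with g^(n) * h^(0) = g^(n) *)
Definition pdf_conv_pow (g : R -> R) n (h : R -> R) m : R -> \bar R :=
  if m is 0 then pdf_convn g n else pdf_conv (pdf_convn g n) (pdf_convn h m).

Definition is_density_on (D : set R) (nu : set R -> \bar R) (p : R -> \bar R) :=
  [/\ measurable_fun D p, (forall s, D s -> (0 <= p s)%E) &
    forall B : set R, measurable B -> B `<=` D ->
      nu B = (\int[lebesgue_measure]_(s in B) p s)%E].

End pdf_convolution.

Section onoff.
Context {d : measure_display} {T : measurableType d} {R : realType}.
Context {P : probability T R}.
(* Sequences are indexed from 0: [U i] is the (i+1)-st on-period, etc. *)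
Variables U S L xi : nat -> {RV P >-> R}.

Fixpoint switch_time (n : nat) (w : T) : R :=
  if n is m.+1 then
    switch_time m w +
    (if ~~ odd m then U m./2 w
     else if xi m./2 w == 1 then S m./2 w else L m./2 w)
  else 0.

Definition in_period (n : nat) (t : R) (w : T) : bool :=
  switch_time n w <= t < switch_time n.+1 w.

(* The last branch, reached only if the switching times accumulate at or
   before t (a null event) or if t < 0, gives the process a conventional
   value. *)
Definition onoff_process (t : R) (w : T) : nat :=
  if `[< exists i, in_period i.*2 t w >] then 0%N
  else if `[< exists i, in_period i.*2.+1 t w /\ xi i w = 1 >] then 1%N
  else if `[< exists i, in_period i.*2.+1 t w /\ xi i w <> 1 >] then 2%N
  else 0%N.

Definition occupation_time (j : nat) (t : R) (w : T) : R :=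
  \int[lebesgue_measure]_(s in `[0, t]) (onoff_process s w == j)%:R.

End onoff.

(* Main.v *)
(* On the event that t lies in the n-th on-period, or in the off-period that
   follows it, with e the set of those i < n whose off-period is of type 1, all
   switching times are sums Z + Y, where Z is the total length of the off-1
   periods in e and Y the total length of the on-periods and off-2 periods so
   far; Z, Y and the types are independent.  In states 0 and 2 the occupation
   time is Z, and t is located by Z + Y <= t < Z + Y' with Y' a longer sum of
   the kind of Y; in state 1 it is t - Y, and t is located by
   Y + Z <= t < Y + Z'.  Integrating against the density of Z, resp. of Y,
   gives the terms of the series; the sum over e with #|e| = k produces the
   binomial coefficient.  Since P(U <= a) < 1 for some a > 0, almost surely
   infinitely many on-periods exceed a, so the switching times diverge. *)

Require Import Defs.
From HB Require Import structures.
From mathcomp Require Import all_boot all_order all_algebra finmap.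
From mathcomp Require Import all_classical all_reals all_analysis.
From mathcomp Require Import measurable_realfun ring lra.

Set Implicit Arguments.
Unset Strict Implicit.
Unset Printing Implicit Defensive.

Import Order.TTheory GRing.Theory Num.Theory.
Import numFieldTopology.Exports numFieldNormedType.Exports.

Local Open Scope classical_set_scope.
Local Open Scope ring_scope.

(** * Independence, densities and convolutions *)

Section independence.
Context {d : measure_display} {T : measurableType d} {R : realType}.
Variable P : probability T R.
Local Open Scope ereal_scope.

(** The sums Y and Y' are dependent, so no joint law of the three variables is used: since Y <= Y',
    the event Z + Y <= t < Z + Y' is a difference of two nested events, each about one independent
    pair. This produces the differences of cdfs in the series. The types enter as a third event
    carried through the independence statements, since fixing the configuration must factor out
    together with the pair.

    The states differ because of atoms. For empty e the sum Z is the constant 0 and has no density;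
    this term alone gives the probability of zero occupation in states 0 and 2, and it vanishes on
    subsets of ]0, t[, so k starts at 1 there. In state 1 the density is that of Y, which always
    contains an on-period; the empty set contributes like any other, and zero occupation has
    probability 0.

    Divergence of the switching times matters for state 0, the conventional value when no period
    contains t. The number a exists because U has no mass at 0 and its cdf is right continuous
    there. *)

Lemma joint_law_event d1 d2 (T1 : measurableType d1) (T2 : measurableType d2)
    (V : {mfun T >-> T1}) (W : {mfun T >-> T2}) (A : set T) : measurable A ->
  (forall B C, measurable B -> measurable C ->
    P (V @^-1` B `&` W @^-1` C `&` A) = P (V @^-1` B) * P (W @^-1` C) * P A) ->
  forall E, measurable E ->
  P ((fun w => (V w, W w)) @^-1` E `&` A) =
    (distribution P V \x distribution P W) E * P A.
Proof.
move=> mA VWA E mE.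
have mVW : measurable_fun setT (fun w => (V w, W w)).
  exact: measurable_fun_pair.
pose VW : {mfun T >-> _} := HB.pack (fun w => (V w, W w))
  (isMeasurableFun.Build _ _ _ _ _ mVW).
pose m0 : {measure set (T1 * T2)%type -> \bar R} :=
  pushforward (mrestr P mA) VW.
have PAfin : P A \is a fin_num by exact: fin_num_measure.
have PA0 : (0 <= fine (P A))%R by apply: fine_ge0.
pose c : {nonneg R} := NngNum PA0.
pose m' := m0 mVW; rewrite -[LHS]/(m' E).
(* The factor [P A] is absorbed into the second marginal by [mscale], so that the right-hand side is
   again a product measure, determined by its values on rectangles. *)
rewrite -(@product_measure_unique _ _ _ _ _ (distribution P V)
   (mscale c (distribution P W)) m') //.
- rewrite /product_measure1/= -[RHS]muleC.
  rewrite -[X in X * _](fineK PAfin) -ge0_integralZl//.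
  exact: measurable_fun_xsection.
- move=> B C mB mC.
  rewrite -[LHS]/(P (V @^-1` B `&` W @^-1` C `&` A)) VWA//.
  rewrite -[RHS]/(P (V @^-1` B) * ((fine (P A))%:E * P (W @^-1` C))).
  by rewrite fineK// [P A * _]muleC muleA.
Qed.

End independence.

(** * Reflection of Lebesgue measure, densities and Stieltjes measures *)

Section density.
Context {R : realType}.
Local Notation mu := (@lebesgue_measure R).
Local Open Scope ereal_scope.

Lemma lebesgue_measure_reflect (a : R) (A : set R) : measurable A ->
  mu ((fun x => a - x)%R @^-1` A) = mu A.
Proof.
have mrefl : measurable_fun setT (fun x : R => a - x)%R.
  exact: measurable_funB.
pose nu0 : {measure set (measurableTypeR R) -> \bar R} :=
  pushforward mu (fun x : measurableTypeR R => a - x : measurableTypeR R)%R.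
pose nu := nu0 mrefl.
move=> mA; rewrite -[LHS]/(nu A); apply/esym/lebesgue_measure_unique => //.
move=> _ [[u v]] _ <-; rewrite -[RHS]/(mu ((fun x => a - x)%R @^-1` `]u, v])).
have -> : (fun x => a - x)%R @^-1` `]u, v] = `[(a - v)%R, (a - u)%R[%classic :> set R.
  by apply/seteqP; split => x /=; rewrite !in_itv/=; lra.
rewrite !lebesgue_measure_itv/= !lte_fin.
have -> : (a - v < a - u)%R = (u < v)%R by apply/idP/idP; lra.
by case: ifP => // _; rewrite -!EFinB; congr EFin; lra.
Qed.

(** The reflection y = t - s is the substitution of state 1, and two reflections compose to a
    translation. *)
Lemma ge0_integral_reflect (a : R) (D : set R) (f : R -> \bar R) :
  measurable D -> measurable_fun D f -> (forall x, D x -> 0 <= f x) ->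
  \int[mu]_(x in (fun x => a - x)%R @^-1` D) f (a - x)%R = \int[mu]_(x in D) f x.
Proof.
move=> mD mf f0.
pose refl (x : measurableTypeR R) : measurableTypeR R := (a - x)%R.
have mrefl : measurable_fun setT refl by exact: measurable_funB.
rewrite -[LHS]/(\int[mu]_(x in refl @^-1` D) (f \o refl) x).
rewrite -(ge0_integral_pushforward mrefl mu mD mf); last first.
  by move=> y /[!inE]; exact: f0.
by apply: eq_measure_integral => B mB _; exact: lebesgue_measure_reflect.
Qed.

Context {d : measure_display} {T : measurableType d}.
Variable P : probability T R.

(* [lebesgue_measure] and the Stieltjes measures live on [measurableTypeR R],
   whose display differs from the one of [R]. *)
Definition borelR (X : {RV P >-> R}) : T -> measurableTypeR R := X.

Let measurable_borelR X : measurable_fun setT (borelR X).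
Proof. by move=> _ B mB; exact: (measurable_funPT X measurableT B mB). Qed.

HB.instance Definition _ (X : {RV P >-> R}) :=
  isMeasurableFun.Build _ _ _ _ (borelR X) (measurable_borelR X).

(** Unlike [has_pdf], this allows infinite values, as needed for the functions produced by
    [pdf_conv]. *)
Definition has_density (X : {RV P >-> R}) (g : R -> \bar R) :=
  [/\ measurable_fun setT g, (forall x, 0 <= g x) &
    forall B : set R, measurable B ->
      distribution P X B = \int[mu]_(x in B) g x].

Lemma density_integrable X g : has_density X g -> mu.-integrable setT g.
Proof.
move=> [mg g0 gE]; apply/integrableP; split => //.
under eq_integral do rewrite gee0_abs//.
by rewrite -gE// probability_setT ltry.
Qed.

Lemma density_dominates X g : has_density X g -> distribution P (borelR X) `<< mu.
Proof.
move=> [mg g0 gE]; apply/null_content_dominatesP => A mA A0.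
by rewrite /= [LHS]gE// null_set_integral//; exact: measurable_funTS.
Qed.

(* Integrability of [f] makes the Radon-Nikodym theorem of the library apply:
   [g] is almost everywhere equal to the derivative it provides. *)
Lemma distribution_integral_density (X : {RV P >-> R}) g f :
  has_density X g -> (distribution P (borelR X)).-integrable setT f ->
  \int[distribution P (borelR X)]_x f x = \int[mu]_x (f x * g x).
Proof.
move=> dX fi; have Xmu := density_dominates dX.
have gi := density_integrable dX.
case: (dX) => mg g0 gE; have mf := measurable_int _ fi.
rewrite -(Radon_Nikodym_change_of_variables Xmu)//.
apply: ae_eq_integral => //.
- by apply: emeasurable_funM.
- by apply: emeasurable_funM.
- apply: ae_eqe_mul2l; apply: integral_ae_eq => //.
    exact: Radon_Nikodym_integrable.
  by move=> E _ mE; rewrite -Radon_Nikodym_integral//= -gE.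
Qed.

(** Both measures agree on half-open intervals, which determine them. This links [cdf_conv], built
    on Stieltjes measures, to the laws of actual random variables. *)
Lemma lebesgue_stieltjes_has_cdf (X : {RV P >-> R})
    (F : cumulativeBounded (0 : R) (1 : R)) (B : set (measurableTypeR R)) :
  has_cdf X F -> measurable B ->
  lebesgue_stieltjes_measure F B = distribution P (borelR X) B.
Proof.
move=> XF mB; apply: lebesgue_stieltjes_measure_unique => // I [[a b]]/= _ <-.
rewrite /lebesgue_stieltjes_measure /measure_extension/=.
rewrite measurable_mu_extE/=; last exact: is_ocitv.
have [ab | ba] := leP a b; last first.
  by rewrite set_itv_ge ?wlength0 ?measure0// bnd_simp -leNgt ltW.
rewrite wlength_itv_bnd// EFinB -!XF.
have -> : `]a, b]%classic = `]-oo, b] `\` `]-oo, a] :> set R.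
  by rewrite -[RHS]setCK setCD setCitvl setUC -[LHS]setCK setCitv.
rewrite -[RHS]/(distribution P X (`]-oo, b] `\` `]-oo, a])).
rewrite measureD ?setIidr//; first exact: subset_itvl.
by rewrite -ge0_fin_numE// fin_num_measure.
Qed.

End density.

(** * Pairs of independent variables together with a third event *)

Section independent_pair.
Context {d : measure_display} {T : measurableType d} {R : realType}.
Variable P : probability T R.
Local Notation mu := (@lebesgue_measure R).
Implicit Types X Y Z : {RV P >-> R}.
Implicit Types F G : cumulativeBounded (0 : R) (1 : R).
Local Open Scope ereal_scope.

(** [A] stands for the event that fixes the types of the off-periods. Plain independence of the pair
    is the case where [A] is the whole space. *)
Definition indep_event (A : set T) X Y :=
  forall B C : set R, measurable B -> measurable C ->
  P (X @^-1` B `&` Y @^-1` C `&` A) = P (X @^-1` B) * P (Y @^-1` C) * P A.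

Lemma joint_law_borelR A X Y E : measurable A -> indep_event A X Y ->
  measurable E ->
  P ((fun w => (borelR X w, borelR Y w)) @^-1` E `&` A) =
  (distribution P (borelR X) \x distribution P (borelR Y)) E * P A.
Proof. by move=> mA XY mE; exact: joint_law_event. Qed.

Lemma cdf_conv_indep X Y Z F G : indep_event setT X Y ->
  (forall w, Z w = X w + Y w)%R ->
  has_cdf X F -> has_cdf Y G -> has_cdf Z (cdf_conv F G).
Proof.
move=> XY ZE XF YG r.
rewrite /cdf_conv /real_cdf fineK ?fin_num_measure//.
have mE : measurable (@pair_sum R @^-1` `]-oo, r]).
  by rewrite -[X in measurable X]setTI; exact: measurable_pair_sum.
rewrite -[RHS]/((lebesgue_stieltjes_measure F \x lebesgue_stieltjes_measure G)
  (@pair_sum R @^-1` `]-oo, r])).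
rewrite (@product_measure_unique _ _ _ _ _ _ _
  (distribution P (borelR X) \x distribution P (borelR Y)))//; last first.
  move=> B C mB mC /=; rewrite product_measure1E//.
  by congr (_ * _); apply/esym/lebesgue_stieltjes_has_cdf.
rewrite -[RHS]mule1 -[X in _ * X](@probability_setT _ _ _ P).
rewrite -joint_law_borelR// setIT.
by rewrite /cdf /distribution /pushforward; congr (P _); apply/seteqP;
  split => w /=; rewrite ZE.
Qed.

(** Given X = s the second condition reads Y <= t - s, so the section of [E] at a point s of B has
    probability G(t - s); integrating over the law of X brings in the density h. *)
Lemma P_density_cdf A X Y h G (B : set R) t : measurable A ->
  indep_event A X Y -> has_density X h -> has_cdf Y G -> measurable B ->
  P (X @^-1` B `&` [set w | X w + Y w <= t]%R `&` A) =
  \int[mu]_(s in B) (h s * (G (t - s)%R)%:E) * P A.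
Proof.
move=> mA XY Xh YG mB.
pose E : set (measurableTypeR R * measurableTypeR R) :=
  [set z | B z.1 /\ (z.1 + z.2 <= t)%R].
have mE : measurable E.
  have -> : E = (fst @^-1` B) `&` (@pair_sum R @^-1` `]-oo, t]).
    by apply/seteqP; split=> z /=; rewrite in_itv.
  apply: measurableI; rewrite -[X in measurable X]setTI.
  - exact: (@measurable_fst _ _ (measurableTypeR R) (measurableTypeR R)).
  - exact: measurable_pair_sum.
transitivity (P ((fun w => (borelR X w, borelR Y w)) @^-1` E `&` A)).
  by congr (P _).
rewrite joint_law_borelR//; congr (_ * _).
(* The integrability required here holds because the section probabilities are at most 1 and the law
   of X is finite. *)
rewrite /product_measure1 (distribution_integral_density Xh); last first.
  apply: (@le_integrable _ _ _ _ _ _ _ (cst 1)) => //=.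
  - exact: measurable_fun_xsection.
  - by move=> x _; rewrite gee0_abs// normr1 probability_le1//; exact: measurable_xsection.
  - exact: finite_measure_integrable_cst.
rewrite [RHS]integral_mkcond; apply: eq_integral => x _.
rewrite patchE; case: ifPn => xB.
- rewrite muleC; congr (_ * _).
  transitivity (distribution P Y `]-oo, (t - x)%R]); last exact: YG.
  congr (P _); apply/seteqP; split => w; rewrite /xsection/= inE /E/= in_itv/=.
    by move=> [_]; rewrite lerBrDl.
  by rewrite lerBrDl => ?; split => //; rewrite inE in xB.
- rewrite /= (_ : xsection E x = set0) ?measure0 ?mul0e//.
  move/negP: xB; rewrite inE => xB.
  by apply/seteqP; split => y //; rewrite /xsection/= inE => -[].
Qed.

End independent_pair.

(** * Densities of sums *)

Section pdf_convolution_theory.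
Context {d : measure_display} {T : measurableType d} {R : realType}.
Variable P : probability T R.
Local Notation mu := (@lebesgue_measure R).
Implicit Types X Y Z : {RV P >-> R}.
Local Open Scope ereal_scope.

(** A translation is a composite of two reflections: both sides become the integral of f (- a - x)
    over the x with - x in D. *)
Lemma ge0_integral_shift (a : R) (D : set R) (f : R -> \bar R) :
  measurable D -> measurable_fun setT f -> (forall x, 0 <= f x) ->
  \int[mu]_(x in (fun x => a + x)%R @^-1` D) f x =
  \int[mu]_(x in D) f (x - a)%R.
Proof.
move=> mD mf f0.
have mfa : measurable_fun setT (fun x : R => f (x - a)%R).
  by apply: measurableT_comp => //; exact: measurable_funB.
have mDa : measurable ((fun x => a + x)%R @^-1` D).
  rewrite -[X in measurable X]setTI.
  by apply: measurable_funD => //; exact: measurable_cst.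
rewrite -(@ge0_integral_reflect _ 0%R D)//; last exact: measurable_funTS.
rewrite -(@ge0_integral_reflect _ (- a)%R)//; last exact: measurable_funTS.
congr (integral _ _ _).
  by apply/seteqP; split => x /=; (have -> : (a + (- a - x) = 0 - x)%R by ring).
by apply/funext => x; congr f; ring.
Qed.

Lemma measurable_convolution_integrand (g h : R -> \bar R) :
  measurable_fun setT g -> measurable_fun setT h ->
  measurable_fun setT (fun z : measurableTypeR R * measurableTypeR R =>
    g z.1 * h (z.2 - z.1)%R).
Proof.
move=> mg mh; apply: emeasurable_funM.
  by apply: (measurableT_comp mg); exact: measurable_fst.
apply: (measurableT_comp mh); apply: measurable_funB.
- exact: (@measurable_snd _ _ (measurableTypeR R) (measurableTypeR R)).
- exact: (@measurable_fst _ _ (measurableTypeR R) (measurableTypeR R)).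
Qed.

Lemma pdf_conv_ge0 (g h : R -> \bar R) x :
  (forall x, 0 <= g x) -> (forall x, 0 <= h x) -> 0 <= pdf_conv g h x.
Proof. by move=> g0 h0; apply: integral_ge0 => y _; exact: mule_ge0. Qed.

Lemma measurable_pdf_conv (g h : R -> \bar R) :
  measurable_fun setT g -> measurable_fun setT h ->
  (forall x, 0 <= g x) -> (forall x, 0 <= h x) ->
  measurable_fun setT (pdf_conv g h).
Proof.
move=> mg mh g0 h0.
move=> _ B mB; apply: (measurable_fun_fubini_tonelli_G (m1 := mu) _
  (measurable_convolution_integrand mg mh)) => // z; exact: mule_ge0.
Qed.

(** Integrating over the law of X gives an iterated integral with the variable of X outside; Tonelli
    exchanges the order, so that the inner integral is [pdf_conv g h] at the value of the sum. *)
Lemma density_conv_indep X Y Z g h : indep_event setT X Y ->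
  (forall w, Z w = X w + Y w)%R ->
  has_density X g -> has_density Y h -> has_density Z (pdf_conv g h).
Proof.
move=> XY ZE Xg Yh; have [mg g0 gE] := Xg; have [mh h0 hE] := Yh.
split => [|x|B mB]; [exact: measurable_pdf_conv|exact: pdf_conv_ge0|].
pose E : set (measurableTypeR R * measurableTypeR R) := @pair_sum R @^-1` B.
have mE : measurable E.
  by rewrite -[X in measurable X]setTI; exact: measurable_pair_sum.
transitivity (P ((fun w => (borelR X w, borelR Y w)) @^-1` E `&` setT)).
  by rewrite setIT; congr (P _); apply/seteqP; split => w /=; rewrite ZE.
rewrite joint_law_borelR// probability_setT mule1.
rewrite /product_measure1 (distribution_integral_density Xg); last first.
  apply: (@le_integrable _ _ _ _ _ _ _ (cst 1)) => //=.
  - exact: measurable_fun_xsection.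
  - by move=> x _; rewrite gee0_abs// normr1 probability_le1//; exact: measurable_xsection.
  - exact: finite_measure_integrable_cst.
have mBz : measurable_fun setT (fun z : measurableTypeR R * measurableTypeR R =>
    (\1_B z.2)%:E : \bar R).
  have mI : measurable_fun setT (fun z : measurableTypeR R => \1_B z : R).
    exact: measurable_indic.
  apply/measurable_EFinP; apply: (measurableT_comp mI).
  exact: (@measurable_snd _ _ (measurableTypeR R) (measurableTypeR R)).
transitivity (\int[mu]_x \int[mu]_z (g x * h (z - x)%R * (\1_B z)%:E)).
  apply: eq_integral => x _ /=.
  transitivity (g x * \int[mu]_(z in B) h (z - x)%R).
    rewrite muleC; congr (_ * _); rewrite -ge0_integral_shift//.
    have mBx : measurable ((fun y => x + y)%R @^-1` B).
      rewrite -[X in measurable X]setTI.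
      by apply: measurable_funD => //; exact: measurable_cst.
    rewrite -hE//; congr (P _); apply/seteqP; split => w;
      by rewrite /xsection/= inE.
  rewrite integral_mkcond -ge0_integralZl//.
  - by apply: eq_integral => z _; rewrite epatch_indic muleA.
  - apply/(measurable_restrictT _ _).1 => //; apply: measurable_funTS.
    by apply: measurableT_comp => //; exact: measurable_funB.
  - by move=> z _; rewrite patchE; case: ifP.
pose f (z : measurableTypeR R * measurableTypeR R) :=
  g z.1 * h (z.2 - z.1)%R * (\1_B z.2)%:E.
have mf : measurable_fun setT f.
  by apply: emeasurable_funM => //; exact: measurable_convolution_integrand.
have f0 z : 0 <= f z.
  by apply: mule_ge0; [exact: mule_ge0|rewrite lee_fin].
rewrite [LHS](@fubini_tonelli _ _ _ _ _ mu mu f)//.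
rewrite [RHS]integral_mkcond; apply: eq_integral => z _.
rewrite epatch_indic /pdf_conv muleC -ge0_integralZl//.
- by apply: eq_integral => x _; rewrite /f muleC.
- exact: (measurableT_comp (measurable_convolution_integrand mg mh)
    (measurable_pair2 z)).
- by move=> x _; exact: mule_ge0.
- by rewrite lee_fin.
Qed.

End pdf_convolution_theory.

(** * Sums over finite lists of indices of one independent sequence *)

Section iid_sums.
Context {d : measure_display} {T : measurableType d} {R : realType}.
Variable P : probability T R.
Local Open Scope ereal_scope.

(** The law of the pair restricted to [A] is its full law times [P A], so the same factor appears
    for every event about the sum. *)
Lemma indep_event_sum (A : set T) (X Y Z : {RV P >-> R}) (B : set R) :
  measurable A -> indep_event setT X Y -> indep_event A X Y ->
  (forall w, Z w = X w + Y w)%R -> measurable B ->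
  P (Z @^-1` B `&` A) = P (Z @^-1` B) * P A.
Proof.
move=> mA XY XYA ZE mB.
have mE : measurable (@pair_sum R @^-1` B).
  by rewrite -[X in measurable X]setTI; exact: measurable_pair_sum.
have ZB : Z @^-1` B = (fun w => (borelR X w, borelR Y w)) @^-1` (@pair_sum R @^-1` B).
  by apply/seteqP; split => w /=; rewrite ZE.
rewrite -[in RHS](setIT (Z @^-1` B)) ZB !joint_law_borelR//.
by rewrite probability_setT mule1.
Qed.

Variable X : nat -> {RV P >-> R}.

(** Indexed by a list rather than a range, because the off-periods of one type occupy arbitrary
    positions. *)
Definition rv_sum (s : seq nat) (w : T) : R := (\sum_(i <- s) X i w)%R.

Let measurable_rv_sum s : measurable_fun setT (rv_sum s).
Proof. by apply: measurable_sum => i; exact: measurable_funPT. Qed.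

HB.instance Definition _ s :=
  isMeasurableFun.Build _ _ _ _ (rv_sum s) (measurable_rv_sum s).

Lemma rv_sum_nil w : rv_sum [::] w = 0%R.
Proof. by rewrite /rv_sum big_nil. Qed.

Lemma rv_sum_cons i s w : rv_sum (i :: s) w = (X i w + rv_sum s w)%R.
Proof. by rewrite /rv_sum big_cons. Qed.

Hypothesis X_indep : mutually_independent P (fun k => sigma_RV (X k)).

Lemma mutually_independent_preimage (J : {fset nat}) (C : nat -> set R) :
  (forall i, measurable (C i)) ->
  P (\bigcap_(i in [set` J]) X i @^-1` C i) = \prod_(i <- J) P (X i @^-1` C i).
Proof.
by move=> mC; apply: X_indep => i _; exists (C i) => //; rewrite setTI.
Qed.

Lemma measurable_bigcap_preimage (J : {fset nat}) (C : nat -> set R) :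
  (forall i, measurable (C i)) ->
  measurable (\bigcap_(i in [set` J]) X i @^-1` C i).
Proof.
move=> mC; apply: bigcap_measurableType => i _.
by rewrite -[X in measurable X]setTI; exact: measurable_funPT.
Qed.

(* The finitely many other coordinates are kept in the statement so that the
   induction on [s] goes through. *)
Lemma rv_sum_indep (s : seq nat) (J : {fset nat}) (B : set R) (C : nat -> set R) :
  uniq s -> (forall i, i \in s -> i \notin J) ->
  measurable B -> (forall i, measurable (C i)) ->
  P (rv_sum s @^-1` B `&` \bigcap_(i in [set` J]) X i @^-1` C i) =
  P (rv_sum s @^-1` B) * \prod_(i <- J) P (X i @^-1` C i).
Proof.
elim: s J B C => [|j s IH] J B C.
  move=> _ _ mB mC; rewrite -mutually_independent_preimage//.
  have [B0|B0] := pselect (B 0%R).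
    rewrite (_ : rv_sum [::] @^-1` B = setT) ?setTI ?probability_setT ?mul1e//.
    by apply/seteqP; split => w //= _; rewrite rv_sum_nil.
  rewrite (_ : rv_sum [::] @^-1` B = set0) ?set0I ?measure0 ?mul0e//.
  by apply/seteqP; split => w //=; rewrite rv_sum_nil.
move=> /= /andP[js us] sJ mB mC.
(* [indep_event_sum] asks for independence of head and tail both alone and jointly with the
   remaining coordinates: K empty and K = J. *)
have key (K : {fset nat}) : j \notin K -> (forall i, i \in s -> i \notin K) ->
    indep_event (\bigcap_(i in [set` K]) X i @^-1` C i) (X j) (rv_sum s).
  move=> jK sK B1 B2 mB1 mB2.
  (* The condition on X j joins those indexed by K, so that the induction hypothesis for the tail
     applies to K with j added. *)
  pose C' i := if i == j then B1 else C i.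
  have mC' i : measurable (C' i) by rewrite /C'; case: ifP.
  have := IH (j |` K)%fset B2 C' us _ mB2 mC'.
  rewrite big_fsetU1//= {2}/C' eqxx.
  rewrite [X in _ * (_ * X)](_ : _ = \prod_(i <- K) P (X i @^-1` C i)); last first.
    apply: eq_big_seq => i iK; rewrite /C'; case: eqP => // ij.
    by rewrite ij (negbTE jK) in iK.
  rewrite -mutually_independent_preimage// => e.
  rewrite -muleA muleCA -e; last first.
    move=> i si; rewrite in_fset1U negb_or sK// andbT.
    by apply: contraNneq js => <-.
  congr (P _); apply/seteqP; split => w /=.
    move=> [[w1 w2] w3]; split => // i /=; rewrite in_fset1U => /orP[/eqP ->|iK].
      by rewrite /C' eqxx.
    by rewrite /C'; case: eqP => [->//|_]; exact: w3.
  move=> [w1 w2]; split; first split => //.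
    by have := w2 j; rewrite /= in_fset1U eqxx /C' eqxx; exact.
  move=> i /= iK; have := w2 i; rewrite /= in_fset1U iK orbT /C'.
  by case: eqP => [ij|_]; [rewrite -ij iK in jK|exact].
rewrite -mutually_independent_preimage//.
have jJ : j \notin J by apply: sJ; rewrite inE eqxx.
have sJ' i : i \in s -> i \notin J by move=> si; apply: sJ; rewrite inE si orbT.
apply: (@indep_event_sum _ (X j) (rv_sum s)) => //.
- exact: measurable_bigcap_preimage.
- have := @key fset0; rewrite bigcap_fset big_seq_fset0; exact.
- exact: key.
- exact: rv_sum_cons.
Qed.

Lemma indep_event_rv_sum j s : j \notin s -> uniq s ->
  indep_event setT (X j) (rv_sum s).
Proof.
move=> js us B C mB mC.
have := @rv_sum_indep s [fset j]%fset C (fun=> B) us _ mC (fun=> mB).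
rewrite big_seq_fset1 set_fset1 bigcap_set1 => e.
rewrite setIT setIC e; last first.
  by move=> i si; rewrite in_fset1; apply: contraNneq js => <-.
rewrite -[P setT]/(P [set: T]) probability_setT mule1; exact: muleC.
Qed.

Lemma has_cdf_rv_sum (F : cumulativeBounded (0 : R) (1 : R)) s :
  (forall k, has_cdf (X k) F) -> uniq s -> has_cdf (P := P) (rv_sum s) (cdf_convn F (size s)).
Proof.
move=> XF; elim: s => [|j [|k s] IH] us.
- move=> r; rewrite /= /cdf_zero /real_cdf fineK ?fin_num_measure//.
  rewrite /cdf /distribution /pushforward.
  rewrite (_ : rv_sum [::] @^-1` _ = if (0 <= r)%R then setT else set0); last first.
    by case: ifPn => r0; apply/seteqP; split => w //=;
      rewrite rv_sum_nil in_itv/= ?(negbTE r0).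
  rewrite (_ : cst 0%R @^-1` _ = if (0 <= r)%R then setT else set0); last first.
    by case: ifPn => r0; apply/seteqP; split => w //=;
      rewrite in_itv/= ?(negbTE r0).
  by case: ifP => _; rewrite ?measure0// !probability_setT.
(* [cdf_convn F 1] is F itself rather than a convolution with [cdf_zero], so one-element lists are
   treated apart. *)
- move=> r; rewrite -(XF j) /cdf /distribution /pushforward; congr (P _).
  by apply/seteqP; split => w /=; rewrite rv_sum_cons rv_sum_nil addr0.
- have /andP[js us'] := us.
  apply: (cdf_conv_indep (indep_event_rv_sum js us') (rv_sum_cons _ _) (XF j)).
  exact: IH.
Qed.

(** The empty list is excluded because its sum is the constant 0, which has no density. *)
Lemma has_density_rv_sum (f : R -> R) s : (forall k, has_pdf (X k) f) ->
  s != [::] -> uniq s -> has_density (P := P) (rv_sum s) (pdf_convn f (size s)).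
Proof.
move=> Xf.
have Xd k : has_density (X k) (EFin \o f).
  by have [mf f0 fE] := Xf k; split => //; exact/measurable_EFinP.
elim: s => [//|j [|k s] IH] _ us.
- have [mf f0 fE] := Xd j; split => // B mB; rewrite -[RHS]fE//; congr (P _).
  by apply/seteqP; split => w /=; rewrite rv_sum_cons rv_sum_nil addr0.
- have /andP[js us'] := us.
  apply: (density_conv_indep (indep_event_rv_sum js us') (rv_sum_cons _ _) (Xd j)).
  exact: IH.
Qed.

(** Independence of the sequences is stated for generated sigma-algebras. Each X k is measurable for
    the one generated by its sequence, and sums inherit this. *)
Lemma sigma_seq_rv_sum s B : measurable B -> sigma_seq X (rv_sum s @^-1` B).
Proof.
move=> mB.
have mX k : measurable_fun setT
    (X k : g_sigma_algebraType (\bigcup_k sigma_RV (X k)) -> R).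
  move=> _ C mC; apply: sub_sigma_algebra; exists k => //.
  by exists C.
have mS : measurable_fun setT
    (rv_sum s : g_sigma_algebraType (\bigcup_k sigma_RV (X k)) -> R).
  exact: measurable_sum.
by have := mS measurableT B mB; rewrite setTI.
Qed.

End iid_sums.

(** * Paths of the on-off process *)

Section onoff_paths.
Context {d : measure_display} {T : measurableType d} {R : realType}.
Variables (P : probability T R) (U S L xi : nat -> {RV P >-> R}).
Hypothesis U_ge0 : forall k w, 0 <= U k w.
Hypothesis S_ge0 : forall k w, 0 <= S k w.
Hypothesis L_ge0 : forall k w, 0 <= L k w.
Local Notation tau := (switch_time U S L xi).
Local Notation period := (in_period U S L xi).
Local Notation X := (onoff_process U S L xi).
Local Notation occ := (occupation_time U S L xi).
Local Notation mu := (@lebesgue_measure R).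

Lemma switch_time_on n w : tau n.*2.+1 w = tau n.*2 w + U n w.
Proof. by rewrite /= odd_double doubleK. Qed.

Lemma switch_time_off n w :
  tau n.+1.*2 w = tau n.*2.+1 w + (if xi n w == 1 then S n w else L n w).
Proof. by rewrite doubleS /= odd_double /= uphalf_double. Qed.

Lemma switch_time_le m n w : (m <= n)%N -> tau m w <= tau n w.
Proof.
elim: n => [|n IH]; first by rewrite leqn0 => /eqP ->.
rewrite leq_eqVlt => /orP[/eqP -> //|/IH]/le_trans; apply.
by rewrite /= lerDl; case: ifP => // _; case: ifP.
Qed.

Lemma switch_time_ge0 n w : 0 <= tau n w.
Proof. exact: (@switch_time_le 0). Qed.

Lemma switch_time0 w : tau 0 w = 0. Proof. by []. Qed.

Lemma measurable_switch_time n : measurable_fun setT (tau n).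
Proof.
elim: n => [|n IH] /=; first exact: measurable_cst.
apply: measurable_funD => //; case: (odd n) => /=; last exact: measurable_funPT.
apply: measurable_fun_ifT; [|exact: measurable_funPT..].
by apply: measurable_fun_eqr; [exact: measurable_funPT|exact: measurable_cst].
Qed.

Local Arguments switch_time : simpl never.

Lemma in_period_inj m n t w : period m t w -> period n t w -> m = n.
Proof.
have wlog_lt a b : period a t w -> period b t w -> (a < b)%N -> False.
  move=> /andP[_ ta] /andP[tb _] /(switch_time_le w) ab.
  by have := lt_le_trans ta (le_trans ab tb); rewrite ltxx.
move=> mt nt; have [mn|nm|//] := ltngtP m n.
- by have := wlog_lt _ _ mt nt mn.
- by have := wlog_lt _ _ nt mt nm.
Qed.

Lemma in_period_on_off m n t w : period m.*2 t w -> period n.*2.+1 t w -> False.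
Proof.
by move=> mt nt; have := in_period_inj mt nt; move/(congr1 odd);
  rewrite /= !odd_double.
Qed.

Lemma onoff_on n t w : period n.*2 t w -> X t w = 0%N.
Proof. by move=> nt; rewrite /onoff_process asboolT//; exists n. Qed.

Lemma onoff_off n t w : period n.*2.+1 t w ->
  X t w = if xi n w == 1 then 1%N else 2%N.
Proof.
move=> nt; rewrite /onoff_process asboolF; last first.
  by move=> [m mt]; exact: in_period_on_off mt nt.
have inj m : period m.*2.+1 t w -> m = n.
  by move=> mt; have [] := in_period_inj mt nt; exact: double_inj.
case: eqP => xi1; first by rewrite asboolT//; exists n.
rewrite asboolF; last by move=> [m [/inj -> ]].
by rewrite asboolT//; exists n.
Qed.

Lemma onoff_eq1 t w : X t w = 1%N <-> exists n, period n.*2.+1 t w /\ xi n w = 1.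
Proof.
split => [|[n [nt xi1]]]; last by rewrite (onoff_off nt) xi1 eqxx.
by rewrite /onoff_process; case: asboolP => // _; case: asboolP => // _; case: asboolP.
Qed.

Lemma onoff_eq2 t w : X t w = 2%N <-> exists n, period n.*2.+1 t w /\ xi n w <> 1.
Proof.
split => [|[n [nt /eqP xi1]]]; last by rewrite (onoff_off nt) (negbTE xi1).
by rewrite /onoff_process; case: asboolP => // _; case: asboolP => // _; case: asboolP.
Qed.

Lemma onoff_eq0 t w : X t w = 0%N <-> ~ exists n, period n.*2.+1 t w.
Proof.
split => [Xt0 [n nt]|nt].
  by move: Xt0; rewrite (onoff_off nt); case: ifP.
rewrite /onoff_process; case: asboolP => // _.
rewrite asboolF ?asboolF//.
- by move=> [n [tn _]]; apply: nt; exists n.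
- by move=> [n [tn _]]; apply: nt; exists n.
Qed.

(** The value 0 is also the conventional one, so an on-period around t need not exist; for t >= 0
    the second alternative leads to the event of [P_explosion]. *)
Lemma onoff_eq0_on t w : X t w = 0%N ->
  (exists n, period n.*2 t w) \/ (forall n, ~~ period n t w).
Proof.
move=> /onoff_eq0 nt.
have [[n tn]|tn] := pselect (exists n, period n t w); last first.
  by right => n; apply/negP => pn; apply: tn; exists n.
left; exists n./2; case on : (odd n).
  by case: nt; exists n./2; rewrite -{1}[n]odd_double_half on in tn.
by rewrite -{1}[n]odd_double_half on in tn.
Qed.

Lemma in_period_or_above t w : 0 <= t ->
  (exists n, period n t w) \/ (forall n, tau n w <= t).
Proof.
move=> t0; have [|nt] := pselect (exists n, period n t w); [by left|right].
elim=> [|n IH]; rewrite ?switch_time0// leNgt; apply/negP => tn.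
by apply: nt; exists n; rewrite /in_period IH.
Qed.

(** Cutting at the start of an on-period makes the set grow by at most one interval per cycle. *)
Definition off1_before n w : set R := [set s | 0 <= s < tau n.*2 w /\ X s w = 1%N].

Lemma off1_beforeS n w : off1_before n.+1 w =
  off1_before n w `|`
  (if xi n w == 1 then `[tau n.*2.+1 w, tau n.+1.*2 w[%classic else set0).
Proof.
have mono1 : tau n.*2 w <= tau n.*2.+1 w by exact: switch_time_le.
have mono2 : tau n.*2.+1 w <= tau n.+1.*2 w by apply: switch_time_le; rewrite doubleS.
rewrite /off1_before; apply/seteqP; split => s /=.
- move=> [/andP[s0 sn] Xs]; have [sn'|ns] := ltP s (tau n.*2 w).
    by left; split => //; rewrite s0.
  right; have [sn1|n1s] := ltP s (tau n.*2.+1 w).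
    by move: Xs; rewrite (@onoff_on n)// /in_period ns.
  have ps : period n.*2.+1 s w by rewrite /in_period n1s -doubleS.
  by move: Xs; rewrite (onoff_off ps); case: ifP.
- move=> [[/andP[s0 sn] Xs]|].
    by rewrite s0 (lt_le_trans sn)//; exact: le_trans mono2.
  case: ifP => // xi1; rewrite /= in_itv/= => /andP[n1s sn].
  rewrite sn (le_trans _ n1s) ?switch_time_ge0//; split => //.
  by rewrite (@onoff_off n) ?xi1// /in_period n1s -doubleS.
Qed.

Lemma off1_until_on n t w : 0 <= t -> period n.*2 t w ->
  [set s | 0 <= s <= t /\ X s w = 1%N] = off1_before n w.
Proof.
move=> t0 pt; have /andP[nt tn] := pt; apply/seteqP; split => s /=.
- move=> [/andP[s0 st] Xs]; split => //; rewrite s0/= ltNge; apply/negP => ns.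
  by move: Xs; rewrite (@onoff_on n)// /in_period ns (le_lt_trans st).
- by move=> [/andP[s0 sn] Xs]; rewrite s0 (le_trans (ltW sn)).
Qed.

Lemma off1_until_off n t w : 0 <= t -> period n.*2.+1 t w ->
  [set s | 0 <= s <= t /\ X s w = 1%N] =
  off1_before n w `|` (if xi n w == 1 then `[tau n.*2.+1 w, t]%classic else set0).
Proof.
move=> t0 pt; have /andP[nt tn] := pt.
have mono1 : tau n.*2 w <= tau n.*2.+1 w by exact: switch_time_le.
apply/seteqP; split => s /=.
- move=> [/andP[s0 st] Xs]; have [sn'|ns] := ltP s (tau n.*2 w).
    by left; split => //; rewrite s0.
  right; have [sn1|n1s] := ltP s (tau n.*2.+1 w).
    by move: Xs; rewrite (@onoff_on n)// /in_period ns.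
  have ps : period n.*2.+1 s w by rewrite /in_period n1s (le_lt_trans st).
  move: Xs; rewrite (onoff_off ps); case: ifP => // _ _.
  by rewrite /= in_itv/= n1s.
- move=> [[/andP[s0 sn] Xs]|].
    by rewrite s0 (le_trans (ltW sn))//; exact: le_trans nt.
  case: ifP => // xi1; rewrite /= in_itv/= => /andP[n1s sn].
  rewrite sn (le_trans _ n1s) ?switch_time_ge0//; split => //.
  by rewrite (@onoff_off n) ?xi1// /in_period n1s (le_lt_trans sn).
Qed.

Lemma measurable_xi_eq1 n : measurable [set w | xi n w = 1].
Proof.
by rewrite -[X in measurable X]setTI; exact: (measurable_funPT (xi n) _ [set 1]).
Qed.

(** Measurability jointly in outcome and time is needed: the occupation time is the measure of a
    section in time, and [measurable_fun_xsection] then makes it a measurable function of the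
    outcome. *)
Lemma measurable_in_period2 n :
  measurable [set z : T * measurableTypeR R | period n z.2 z.1].
Proof.
have mtau m : measurable_fun setT (fun z : T * measurableTypeR R => tau m z.1).
  exact: (measurableT_comp (measurable_switch_time m)
    (@measurable_fst _ _ T (measurableTypeR R))).
have msnd : measurable_fun setT (fun z : T * measurableTypeR R => z.2 : R).
  exact: (@measurable_snd _ _ T (measurableTypeR R)).
have mp : measurable_fun setT (fun z : T * measurableTypeR R => period n z.2 z.1).
  by apply: measurable_and; [exact: measurable_fun_ler|exact: measurable_fun_ltr].
have := mp measurableT [set true]; rewrite setTI; exact.
Qed.

Lemma measurable_onoff_eq1 :
  measurable [set z : T * measurableTypeR R | X z.2 z.1 = 1%N].
Proof.
rewrite (_ : [set _ | _] = \bigcup_n ([set z | period n.*2.+1 z.2 z.1] `&`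
    fst @^-1` [set w | xi n w = 1])); last first.
  apply/seteqP; split => z /=.
    by move=> /onoff_eq1[n [pn xi1]]; exists n.
  by move=> [n _ [pn xi1]]; apply/onoff_eq1; exists n.
apply: bigcupT_measurable => n; apply: measurableI.
  exact: measurable_in_period2.
rewrite -[X in measurable X]setTI; apply: (@measurable_fst _ _ T (measurableTypeR R)) => //.
exact: measurable_xi_eq1.
Qed.

Lemma measurable_in_period n t : measurable [set w | period n t w].
Proof.
have mp : measurable_fun setT (fun w => period n t w).
  apply: measurable_and; [apply: measurable_fun_ler|apply: measurable_fun_ltr] => //;
  exact: measurable_switch_time.
by have := mp measurableT [set true]; rewrite setTI; exact.
Qed.

Lemma measurable_onoff t j : measurable [set w | X t w = j].
Proof.
have m1 : measurable [set w | X t w = 1%N].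
  rewrite (_ : [set _ | _] = \bigcup_n ([set w | period n.*2.+1 t w] `&`
      [set w | xi n w = 1])); last first.
    apply/seteqP; split => w /=.
      by move=> /onoff_eq1[n [pn xi1]]; exists n.
    by move=> [n _ [pn xi1]]; apply/onoff_eq1; exists n.
  apply: bigcupT_measurable => n; apply: measurableI.
    exact: measurable_in_period.
  exact: measurable_xi_eq1.
have m2 : measurable [set w | X t w = 2%N].
  rewrite (_ : [set _ | _] = \bigcup_n ([set w | period n.*2.+1 t w] `&`
      ~` [set w | xi n w = 1])); last first.
    apply/seteqP; split => w /=.
      by move=> /onoff_eq2[n [pn xi1]]; exists n.
    by move=> [n _ [pn xi1]]; apply/onoff_eq2; exists n.
  apply: bigcupT_measurable => n; apply: measurableI.
    exact: measurable_in_period.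
  by apply: measurableC; exact: measurable_xi_eq1.
case: j => [|[|[|j]]] //.
(* State 0 collects the on-periods and the conventional value, so it is handled as the complement of
   the other two states. *)
- rewrite (_ : [set _ | _] = ~` ([set w | X t w = 1%N] `|` [set w | X t w = 2%N])).
    by apply: measurableC; exact: measurableU.
  apply/seteqP; split => w /=; first by move=> ->; case.
  rewrite /onoff_process; case: asboolP => // _; case: asboolP => // _.
    by move=> []; left.
  by case: asboolP => // _ []; right.
- rewrite (_ : [set _ | _] = set0)//; apply/seteqP; split => w //=.
  by rewrite /onoff_process; case: asboolP => // _; case: asboolP => // _;
    case: asboolP.
Qed.

Lemma occupation_timeE t w :
  occ 1 t w = fine (mu [set s | 0 <= s <= t /\ X s w = 1%N]).
Proof.
have mX : measurable [set s : measurableTypeR R | X s w = 1%N].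
  have := measurable_xsection w measurable_onoff_eq1.
  by congr measurable; apply/seteqP; split => s; rewrite /xsection/= inE.
rewrite /occupation_time /Rintegral; congr fine.
transitivity (\int[mu]_(s in `[0%R, t]) (\1_[set s | X s w = 1%N] s)%:E)%E.
  apply: eq_integral => s _; rewrite indicE; congr (_%:R%:E).
  by congr nat_of_bool; apply/eqP/idP; rewrite inE.
rewrite integral_indic//; congr (mu _).
by apply/seteqP; split => s /=; rewrite in_itv/= => -[].
Qed.

Lemma measurable_occupation_time t : measurable_fun setT (occ 1 t).
Proof.
have mE : measurable [set z : T * measurableTypeR R |
    0 <= z.2 <= t /\ X z.2 z.1 = 1%N].
  rewrite (_ : [set _ | _] = snd @^-1` `[0, t]%classic `&`
      [set z | X z.2 z.1 = 1%N]); last first.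
    by apply/seteqP; split => z /=; rewrite in_itv.
  apply: measurableI; last exact: measurable_onoff_eq1.
  rewrite -[X in measurable X]setTI.
  exact: (@measurable_snd _ _ T (measurableTypeR R)).
rewrite (_ : occ 1 t = fun w => fine (mu (xsection [set z : T * measurableTypeR R |
    0 <= z.2 <= t /\ X z.2 z.1 = 1%N] w))).
  apply: measurableT_comp => //; exact: measurable_fun_xsection.
apply/funext => w; rewrite occupation_timeE; congr (fine (mu _)).
by apply/seteqP; split => s; rewrite /xsection/= inE.
Qed.

(** Each completed off-1 period contributes a half-open interval of length [S i w]. Measurability is
    carried along because additivity in the induction step requires it. *)
Lemma off1_before_measure n w :
  measurable (off1_before n w : set (measurableTypeR R)) /\
  mu (off1_before n w) = (\sum_(i < n | xi i w == 1) S i w)%:E.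
Proof.
elim: n => [|n [mn en]].
  rewrite big_ord0 (_ : off1_before 0 w = set0) ?measure0//.
  by apply/seteqP; split => s //= [/andP[s0]]; rewrite [X in _ < X]switch_time0 ltNge s0.
rewrite off1_beforeS// big_mkcond big_ord_recr/= -big_mkcond/=.
case: ifP => xi1; last by rewrite setU0 addr0.
have mono : tau n.*2 w <= tau n.*2.+1 w by exact: switch_time_le.
split; first exact: measurableU.
rewrite [LHS](_ : _ = (mu (off1_before n w) +
    mu `[tau n.*2.+1 w, tau n.+1.*2 w[%classic)%E); last first.
  rewrite measureU//.
  apply/seteqP; split => s //= [[/andP[_ sn] _]]; rewrite in_itv/= => /andP[ns _].
  by have := lt_le_trans sn (le_trans mono ns); rewrite ltxx.
rewrite en EFinD lebesgue_measure_itv/= lte_fin switch_time_off xi1.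
rewrite -EFinB [_ + S n w]addrC addrK addrC; congr (_ + _)%E.
(* If the interval is empty, its measure 0 must still equal [S n w]; sign and emptiness together
   force this. *)
case: ltP => // Sn; congr EFin; apply/eqP; rewrite eq_le S_ge0.
by move: Sn; rewrite gerDl => ->.
Qed.

Lemma occupation_time_on n t w : 0 <= t -> period n.*2 t w ->
  occ 1 t w = \sum_(i < n | xi i w == 1) S i w.
Proof.
move=> t0 pt; rewrite occupation_timeE (off1_until_on t0 pt).
by have [_ ->] := off1_before_measure n w.
Qed.

Lemma occupation_time_off n t w : 0 <= t -> period n.*2.+1 t w ->
  occ 1 t w = \sum_(i < n | xi i w == 1) S i w +
    (if xi n w == 1 then t - tau n.*2.+1 w else 0).
Proof.
move=> t0 pt; rewrite occupation_timeE (off1_until_off t0 pt).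
have [mn en] := off1_before_measure n w.
case: ifP => xi1; last by rewrite setU0 en addr0.
have mono : tau n.*2 w <= tau n.*2.+1 w by exact: switch_time_le.
rewrite [mu _](_ : _ = (mu (off1_before n w) +
    mu `[tau n.*2.+1 w, t]%classic)%E); last first.
  rewrite measureU//.
  apply/seteqP; split => s //= [[/andP[_ sn] _]]; rewrite in_itv/= => /andP[ns _].
  by have := lt_le_trans sn (le_trans mono ns); rewrite ltxx.
have /andP[nt _] := pt.
rewrite [in LHS]en lebesgue_measure_itv/= lte_fin -EFinB.
(* The closed interval degenerates to a point when t is the switching time itself. *)
case: ltP => // tn.
have -> : t = tau n.*2.+1 w by apply/le_anti; rewrite tn nt.
by rewrite subrr !addr0.
Qed.

End onoff_paths.

(** * Switching times and occupation time given the types of the off-periods *)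

Section onoff_configurations.
Context {d : measure_display} {T : measurableType d} {R : realType}.
Variables (P : probability T R) (U S L xi : nat -> {RV P >-> R}).
Hypothesis U_ge0 : forall k w, 0 <= U k w.
Hypothesis S_ge0 : forall k w, 0 <= S k w.
Hypothesis L_ge0 : forall k w, 0 <= L k w.
Local Notation tau := (switch_time U S L xi).
Local Notation period := (in_period U S L xi).
Local Notation X := (onoff_process U S L xi).
Local Notation occ := (occupation_time U S L xi).

(** The set itself is recorded, not only its cardinality: once it is fixed, all sums run over fixed
    lists and independence applies, whereas equal cardinality only gives equal laws. *)
Definition config n w : {set 'I_n} := [set i : 'I_n | xi i w == 1].

Definition ord_seq n (e : {set 'I_n}) : seq nat := [seq val i | i <- enum e].

Lemma size_ord_seq n (e : {set 'I_n}) : size (ord_seq e) = #|e|.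
Proof. by rewrite size_map -cardE. Qed.

Lemma ord_seq_uniq n (e : {set 'I_n}) : uniq (ord_seq e).
Proof. by rewrite map_inj_uniq ?enum_uniq//; exact: val_inj. Qed.

Lemma ord_seq_notin n (e : {set 'I_n}) : n \notin ord_seq e.
Proof. by apply/mapP => -[i _ ni]; have := ltn_ord i; rewrite -ni ltnn. Qed.

(** Adding the current index n yields the longer sums Z' and Y'; since no index repeats, their laws
    are convolutions with one more factor. *)
Lemma ord_seq_cons_uniq n (e : {set 'I_n}) : uniq (n :: ord_seq e).
Proof. by rewrite /= ord_seq_notin ord_seq_uniq. Qed.

Lemma rv_sum_ord_seq (Y : nat -> {RV P >-> R}) n (e : {set 'I_n}) w :
  rv_sum Y (ord_seq e) w = \sum_(i < n | i \in e) Y i w.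
Proof. by rewrite /rv_sum big_map big_enum. Qed.

Lemma rv_sum_iota (Y : nat -> {RV P >-> R}) n w :
  rv_sum Y (iota 0 n) w = \sum_(i < n) Y i w.
Proof. by rewrite /rv_sum -[n in iota 0 n]subn0 -/(index_iota 0 n) big_mkord. Qed.

Lemma switch_time_config n w : tau n.*2 w =
  rv_sum S (ord_seq (config n w)) w +
  (rv_sum U (iota 0 n) w + rv_sum L (ord_seq (~: config n w)) w).
Proof.
have -> : tau n.*2 w =
    \sum_(i < n) (U i w + if xi i w == 1 then S i w else L i w).
  elim: n => [|n IH]; first by rewrite big_ord0.
  by rewrite switch_time_off switch_time_on IH big_ord_recr/= addrA.
rewrite big_split/= rv_sum_iota !rv_sum_ord_seq addrCA; congr (_ + _).
rewrite (bigID (fun i : 'I_n => xi i w == 1))/=; congr (_ + _).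
  by apply: eq_big => [i|i ->//]; rewrite inE.
by apply: eq_big => [i|i /negbTE ->//]; rewrite !inE.
Qed.

Lemma sum_off1_config n w :
  \sum_(i < n | xi i w == 1) S i w = rv_sum S (ord_seq (config n w)) w.
Proof. by rewrite rv_sum_ord_seq; apply: eq_bigl => i; rewrite inE. Qed.

Let measurable_rv_add (Y Z : {RV P >-> R}) : measurable_fun setT (Y \+ Z).
Proof. by apply: measurable_funD; exact: measurable_funPT. Qed.

Definition rv_add (Y Z : {RV P >-> R}) (w : T) : R := Y w + Z w.

HB.instance Definition _ (Y Z : {RV P >-> R}) :=
  isMeasurableFun.Build _ _ _ _ (rv_add Y Z) (measurable_rv_add Y Z).

(* Time spent outside state 1 after [n] on-periods and the off-2 periods
   listed in [l]. *)
Definition rest_time n (l : seq nat) : {RV P >-> R} :=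
  rv_add (rv_sum U (iota 0 n)) (rv_sum L l).

Lemma rest_timeE n (l : seq nat) w :
  rest_time n l w = \sum_(i < n) U i w + rv_sum L l w.
Proof. by rewrite -rv_sum_iota. Qed.

Lemma rest_time_le n (l : seq nat) w : rest_time n l w <= rest_time n.+1 l w.
Proof.
by rewrite !rest_timeE lerD2r big_ord_recr/= lerDl.
Qed.

Lemma rest_time_cons_le n i (l : seq nat) w :
  rest_time n l w <= rest_time n (i :: l) w.
Proof. by rewrite !rest_timeE lerD2l rv_sum_cons lerDr. Qed.

Lemma in_period_onE n t w (Z := rv_sum S (ord_seq (config n w)) w)
    (l := ord_seq (~: config n w)) :
  period n.*2 t w = (Z + rest_time n l w <= t < Z + rest_time n.+1 l w).
Proof.
rewrite /in_period switch_time_on switch_time_config -/Z -/l.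
rewrite rv_sum_iota !rest_timeE big_ord_recr/=.
by congr (_ && (_ < _)); ring.
Qed.

Lemma switch_time_on_config n w : tau n.*2.+1 w =
  rv_sum S (ord_seq (config n w)) w + rest_time n.+1 (ord_seq (~: config n w)) w.
Proof.
rewrite switch_time_on switch_time_config rest_timeE rv_sum_iota.
by rewrite big_ord_recr/=; ring.
Qed.

Lemma in_period_off1E n t w (Z := rv_sum S (ord_seq (config n w)) w)
    (l := ord_seq (~: config n w)) : xi n w = 1 ->
  period n.*2.+1 t w =
  (rest_time n.+1 l w + Z <= t <
   rest_time n.+1 l w + rv_sum S (n :: ord_seq (config n w)) w).
Proof.
move=> xi1; rewrite /in_period -doubleS switch_time_off switch_time_on_config.
rewrite -/Z -/l xi1 eqxx rv_sum_cons -/Z [_ + Z]addrC.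
by congr (_ && (_ < _)); ring.
Qed.

Lemma in_period_off2E n t w (Z := rv_sum S (ord_seq (config n w)) w)
    (l := ord_seq (~: config n w)) : xi n w <> 1 ->
  period n.*2.+1 t w =
  (Z + rest_time n.+1 l w <= t < Z + rest_time n.+1 (n :: l) w).
Proof.
move=> /eqP/negbTE xi1; rewrite /in_period -doubleS switch_time_off.
rewrite switch_time_on_config -/Z -/l xi1 !rest_timeE rv_sum_cons.
by congr (_ && (_ < _)); ring.
Qed.

(** The completed off-1 periods give Z and the current one has lasted t - (Z + Y), so Z cancels. *)
Lemma occupation_time_off1_config n t w : 0 <= t -> period n.*2.+1 t w ->
  xi n w = 1 ->
  occ 1 t w = t - rest_time n.+1 (ord_seq (~: config n w)) w.
Proof.
move=> t0 pt xi1; rewrite (occupation_time_off U_ge0 S_ge0 L_ge0 t0 pt).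
by rewrite xi1 eqxx sum_off1_config switch_time_on_config; ring.
Qed.

Lemma occupation_time_off2_config n t w : 0 <= t -> period n.*2.+1 t w ->
  xi n w <> 1 -> occ 1 t w = rv_sum S (ord_seq (config n w)) w.
Proof.
move=> t0 pt /eqP/negbTE xi1; rewrite (occupation_time_off U_ge0 S_ge0 L_ge0 t0 pt).
by rewrite xi1 sum_off1_config addr0.
Qed.

Lemma occupation_time_on_config n t w : 0 <= t -> period n.*2 t w ->
  occ 1 t w = rv_sum S (ord_seq (config n w)) w.
Proof.
move=> t0 pt; rewrite (occupation_time_on U_ge0 S_ge0 L_ge0 t0 pt).
exact: sum_off1_config.
Qed.

(** Turns the configuration into a sequence of bits, the form in which [pattern] gives its
    probability. *)
Lemma configP n (e : {set 'I_n}) w :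
  config n w = e <-> forall i, (i < n)%N -> (xi i w == 1) = (i \in ord_seq e).
Proof.
have mem (i : 'I_n) : (val i \in ord_seq e) = (i \in e).
  by rewrite mem_map ?mem_enum//; exact: val_inj.
split=> [<- i iltn|h].
  by have -> : i = val (Ordinal iltn) by []; rewrite mem_map ?mem_enum ?inE//; exact: val_inj.
by apply/setP => i; rewrite inE h// mem.
Qed.

End onoff_configurations.

(** * Consequences of the independence of the four sequences *)

Section four_independent_sequences.
Context {d : measure_display} {T : measurableType d} {R : realType}.
Variables (P : probability T R) (U S L xi : nat -> {RV P >-> R}).
Hypothesis indep : mutually_independent P
  (fun j : 'I_4 => sigma_seq (tnth [tuple U; S; L; xi] j)).
Local Open Scope ereal_scope.

Lemma sigma_seqT (Y : nat -> {RV P >-> R}) : sigma_seq Y setT.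
Proof.
by rewrite -(preimage_setT (rv_sum Y [::])); exact: sigma_seq_rv_sum.
Qed.

Lemma sigma_seq_measurable (Y : nat -> {RV P >-> R}) A :
  sigma_seq Y A -> measurable A.
Proof.
move: A; apply: smallest_sub; first exact: sigma_algebra_measurable.
by move=> _ [k _ [B mB <-]]; exact: measurable_funPT.
Qed.

(** The hypothesis is applied to the full set of four indices. Taking the whole space in one slot
    removes that sequence from the product. *)
Lemma four_indep A B C D : sigma_seq U A -> sigma_seq S B -> sigma_seq L C ->
  sigma_seq xi D -> P (A `&` B `&` C `&` D) = P A * P B * P C * P D.
Proof.
move=> UA SB LC xiD.
pose o (i : nat) : 'I_4 := inord i.
have oE i j : (i < 4)%N -> (j < 4)%N -> (o i == o j) = (i == j).
  by move=> i4 j4; rewrite -val_eqE/= !inordK.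
pose J := (o 0%N |` (o 1%N |` (o 2%N |` [fset o 3%N])))%fset.
pose F (j : 'I_4) := tnth [tuple A; B; C; D] j.
have -> : A `&` B `&` C `&` D = \bigcap_(i in [set` J]) F i.
  apply/seteqP; split => w.
    move=> [[[wA wB] wC] wD] i _.
    by case: i => -[|[|[|[|i]]]] //= ilt; rewrite /F (tnth_nth setT).
  move=> h; have hJ k : (k < 4)%N -> nth setT [:: A; B; C; D] k w.
    move=> k4; have := h (o k); rewrite /F (tnth_nth setT)/= inordK//; apply.
    by case: k k4 => [|[|[|[|]]]] // _; rewrite /J !inE eqxx ?orbT.
  by split; [split; [split|]|]; [exact: (hJ 0%N)|exact: (hJ 1%N)|
     exact: (hJ 2%N)|exact: (hJ 3%N)].
rewrite indep.
  rewrite /J !big_fsetU1/= ?big_seq_fset1 ?inE ?oE//.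
  by rewrite /F !(tnth_nth setT)/= !inordK//= !muleA.
move=> i _; rewrite /F.
by case: i => -[|[|[|[|i]]]] //= ilt;
  rewrite (tnth_nth setT) (tnth_nth U).
Qed.

Lemma rv_sum_UL_indep a b : indep_event (P := P) setT (rv_sum U a) (rv_sum L b).
Proof.
move=> C1 C2 mC1 mC2.
have := four_indep (sigma_seq_rv_sum (X := U) a mC1) (@sigma_seqT S)
  (sigma_seq_rv_sum (X := L) b mC2) (@sigma_seqT xi).
by rewrite !setIT !(@probability_setT _ _ _ P) !mule1.
Qed.

(** The condition on [rv_sum S c] together with [A] serves as the third event of [indep_event_sum],
    applied to the sums of [U] and of [L]; this third event itself splits by the independence of [S]
    and [xi]. *)
Lemma rest_time_indep n l c A : sigma_seq xi A ->
  indep_event A (rv_sum S c) (rest_time U L n l).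
Proof.
move=> xiA B C mB mC; have mA := sigma_seq_measurable xiA.
have SA D E : sigma_seq S D -> sigma_seq xi E -> P (D `&` E) = P D * P E.
  move=> SD xiE; have := four_indep (@sigma_seqT U) SD (@sigma_seqT L) xiE.
  by rewrite setTI setIT probability_setT mul1e mule1.
have UL D E : sigma_seq S D -> sigma_seq xi E ->
    indep_event (P := P) (D `&` E) (rv_sum U (iota 0 n)) (rv_sum L l).
  move=> SD xiE C1 C2 mC1 mC2; rewrite SA//.
  have := four_indep (sigma_seq_rv_sum (X := U) (iota 0 n) mC1) SD
    (sigma_seq_rv_sum (X := L) l mC2) xiE.
  rewrite -!muleA [P D * (_ * _)]muleCA => <-; congr (P _).
  by apply/seteqP; split => w; [move=> [[? ?] [? ?]]|move=> [[[? ?] ?] ?]].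
have ULT := rv_sum_UL_indep (iota 0 n) l.
have SB := sigma_seq_rv_sum (X := S) c mB.
rewrite -setIA setICA (@indep_event_sum _ _ _ P _ (rv_sum U (iota 0 n)) (rv_sum L l)
  (rest_time U L n l))//.
- by rewrite SA// muleCA muleA.
- by apply: measurableI => //; exact: sigma_seq_measurable SB.
- exact: UL.
Qed.

End four_independent_sequences.

(** * Crossing probabilities *)

Section crossing_events.
Context {d : measure_display} {T : measurableType d} {R : realType}.
Variable P : probability T R.
Local Notation mu := (@lebesgue_measure R).
Implicit Types (F G : cumulativeBounded (0 : R) (1 : R)) (X Y Z : {RV P >-> R}).
Local Open Scope ereal_scope.

Lemma measurable_cumulativeBounded F : measurable_fun setT F.
Proof. exact: nondecreasing_measurable (cumulative_is_nondecreasing F). Qed.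

Lemma has_cdf_ge0 Y G r : has_cdf Y G -> (0 <= G r)%R.
Proof. by move=> YG; rewrite -lee_fin -YG cdf_ge0. Qed.

Lemma measurable_le_level Y t : measurable [set w | Y w <= t]%R.
Proof.
have -> : [set w | Y w <= t]%R = Y @^-1` `]-oo, t].
  by apply/seteqP; split => w /=; rewrite in_itv.
by rewrite -[X in measurable X]setTI; exact: measurable_funPT.
Qed.

Lemma has_cdfE Y G t : has_cdf Y G -> P [set w | Y w <= t]%R = (G t)%:E.
Proof. by move=> <-. Qed.

Lemma has_cdf_le Y Z F G r : has_cdf Y F -> has_cdf Z G ->
  (forall w, Y w <= Z w)%R -> (G r <= F r)%R.
Proof.
move=> YF ZG YZ; rewrite -lee_fin -(has_cdfE _ YF) -(has_cdfE _ ZG).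
apply: le_measure => [||w /=]; last exact: le_trans.
  by rewrite inE; exact: measurable_le_level.
by rewrite inE; exact: measurable_le_level.
Qed.

(** Serves the case of no off-1 period, where the added variable is 0 and has no density. The event
    is the difference of Y <= t and the smaller event Z <= t. *)
Lemma P_crossing (A : set T) Y Z F G t : measurable A ->
  (forall C : set R, measurable C -> P (Y @^-1` C `&` A) = P (Y @^-1` C) * P A) ->
  (forall C : set R, measurable C -> P (Z @^-1` C `&` A) = P (Z @^-1` C) * P A) ->
  has_cdf Y F -> has_cdf Z G -> (forall w, Y w <= Z w)%R ->
  P ([set w | Y w <= t < Z w]%R `&` A) = (F t - G t)%R%:E * P A.
Proof.
move=> mA YA ZA YF ZG YZ.
have cdfE (W : {RV P >-> R}) (H : cumulativeBounded (0%R : R) (1%R : R)) :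
    has_cdf W H ->
    (forall C : set R, measurable C -> P (W @^-1` C `&` A) = P (W @^-1` C) * P A) ->
    P ([set w | W w <= t]%R `&` A) = (H t)%:E * P A.
  move=> WH WA; rewrite -(has_cdfE _ WH).
  have -> : [set w | W w <= t]%R = W @^-1` `]-oo, t].
    by apply/seteqP; split => w /=; rewrite in_itv.
  exact: WA.
rewrite (_ : _ `&` A = ([set w | Y w <= t]%R `&` A) `\`
    ([set w | Z w <= t]%R `&` A)); last first.
  apply/seteqP; split => w /=.
    by move=> [/andP[Yt tZ] wA]; split => // -[]; rewrite leNgt tZ.
  move=> [[Yt wA] nZ]; split => //; rewrite Yt/= ltNge; apply/negP => Zt.
  exact: nZ.
rewrite measureD; last 3 first.
- by apply: measurableI => //; exact: measurable_le_level.
- by apply: measurableI => //; exact: measurable_le_level.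
- by rewrite -ge0_fin_numE// fin_num_measure//; apply: measurableI => //;
    exact: measurable_le_level.
rewrite (@setIidr _ (_ `&` A) (_ `&` A)); last first.
  by apply: setSI => w /= Zt; exact: le_trans (YZ w) Zt.
rewrite -[X in X - _]/(P _) -[X in _ - X]/(P _).
rewrite (cdfE _ _ YF YA) (cdfE _ _ ZG ZA) EFinB muleBl ?fin_num_measure//.
Qed.

Lemma P_density_crossing (A : set T) X Y Z h F G (B : set R) t :
  measurable A -> indep_event A X Y -> indep_event A X Z -> has_density X h ->
  has_cdf Y F -> has_cdf Z G -> (forall w, Y w <= Z w)%R -> measurable B ->
  P (X @^-1` B `&` [set w | X w + Y w <= t < X w + Z w]%R `&` A) =
  \int[mu]_(s in B) (h s * (F (t - s) - G (t - s))%R%:E) * P A.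
Proof.
move=> mA XY XZ Xh YF ZG YZ mB.
have mE (W : {RV P >-> R}) : measurable (X @^-1` B `&` [set w | X w + W w <= t]%R `&` A).
  apply: measurableI => //; apply: measurableI.
    by rewrite -[X in measurable X]setTI; exact: measurable_funPT.
  exact: (measurable_le_level (rv_add X W)).
have [mh h0 _] := Xh.
have mH (H : cumulativeBounded (0%R : R) (1%R : R)) : measurable_fun B (fun s => h s * (H (t - s)%R)%:E).
  apply: measurable_funTS; apply: emeasurable_funM => //.
  apply/measurable_EFinP; apply: (measurableT_comp (measurable_cumulativeBounded H)).
  exact: measurable_funB.
rewrite (_ : _ `&` A = (X @^-1` B `&` [set w | X w + Y w <= t]%R `&` A) `\`
    (X @^-1` B `&` [set w | X w + Z w <= t]%R `&` A)); last first.
  apply/seteqP; split => w /=.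
    by move=> [[XB /andP[Yt tZ]] wA]; split => // -[[_]]; rewrite leNgt tZ.
  move=> [[[XB Yt] wA] nZ]; split => //; split => //; rewrite Yt/= ltNge.
  by apply/negP => Zt; exact: nZ.
rewrite measureD//; last by rewrite -ge0_fin_numE// fin_num_measure.
rewrite (@setIidr _ (_ `&` A) (_ `&` A)); last first.
  apply: setSI => w /= [XB Zt]; split => //.
  by apply: le_trans Zt; rewrite lerD2l.
rewrite -[X in X - _]/(P _) -[X in _ - X]/(P _).
rewrite (P_density_cdf _ mA XY Xh YF)// (P_density_cdf _ mA XZ Xh ZG)//.
(* Writing F as (F - G) + G keeps every integrand non-negative; the G part times [P A] is a
   probability, hence finite, and cancels. *)
rewrite (_ : \int[mu]_(s in B) (h s * (F (t - s)%R)%:E) =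
  \int[mu]_(s in B) (h s * (F (t - s) - G (t - s))%R%:E) +
  \int[mu]_(s in B) (h s * (G (t - s)%R)%:E)); last first.
  rewrite -ge0_integralD//.
  - apply: eq_integral => s _; rewrite -ge0_muleDr.
    + by rewrite -EFinD subrK.
    + by rewrite lee_fin subr_ge0; exact: has_cdf_le YZ.
    + by rewrite lee_fin; exact: has_cdf_ge0 ZG.
  - by move=> s _; rewrite mule_ge0// lee_fin subr_ge0; exact: has_cdf_le YZ.
  - apply: measurable_funTS; apply: emeasurable_funM => //.
    apply/measurable_EFinP; apply: measurable_funB.
      apply: (measurableT_comp (measurable_cumulativeBounded F)).
      exact: measurable_funB.
    apply: (measurableT_comp (measurable_cumulativeBounded G)).
    exact: measurable_funB.
  - by move=> s _; rewrite mule_ge0// lee_fin; exact: has_cdf_ge0 ZG.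
  - exact: mH.
rewrite ge0_muleDl; last 2 first.
- by apply: integral_ge0 => s _; rewrite mule_ge0// lee_fin subr_ge0; exact: has_cdf_le YZ.
- by apply: integral_ge0 => s _; rewrite mule_ge0// lee_fin; exact: has_cdf_ge0 ZG.
rewrite addeK//.
by rewrite -(P_density_cdf _ mA XZ Xh ZG mB) fin_num_measure.
Qed.

(** Mutual independence speaks of products over [{fset nat}], while the probabilities of patterns
    are products over initial segments; this passes from one to the other. *)
Lemma exists_fset_ltn (m : nat) (F : nat -> \bar R) : exists J : {fset nat},
  (forall i, (i \in J) = (i < m)%N) /\ \prod_(i <- J) F i = \prod_(i < m) F i.
Proof.
elim: m => [|m [J [JE JF]]].
  by exists fset0; split => [i|]; [rewrite inE|rewrite big_ord0 big_seq_fset0].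
exists (m |` J)%fset; split => [i|]; first by rewrite in_fset1U JE [RHS]ltnS [RHS]leq_eqVlt.
by rewrite big_fsetU1 ?JE ?ltnn// big_ord_recr/= JF muleC.
Qed.

Lemma sigma_seq_bigcap (Y : nat -> {RV P >-> R}) (C : nat -> set R) (J : set nat) :
  (forall i, measurable (C i)) ->
  sigma_seq Y (\bigcap_(i in J) Y i @^-1` C i).
Proof.
move=> mC; pose G := \bigcup_k sigma_RV (Y k).
apply: (@bigcap_measurableType _ (g_sigma_algebraType G)) => i _.
by apply: sub_sigma_algebra; exists i => //; exists (C i) => //; rewrite setTI.
Qed.

(** * Probabilities of finite patterns of types *)

Section bernoulli_pattern.
Variables (xi : nat -> {RV P >-> R}) (p1 p2 : R).
Hypothesis xi_indep : mutually_independent P (fun k => sigma_RV (xi k)).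
Hypothesis p2E : p2 = (1 - p1)%R.
Hypothesis xi_1 : forall k, P [set w | xi k w = 1%R] = p1%:E.

(** A false bit means a value other than 1, in accordance with the test in [switch_time]; its
    probability is that of the complement, 1 - p1. *)
Definition pattern m (b : pred nat) : set T :=
  [set w | forall i, (i < m)%N -> (xi i w == 1%R) = b i].

Let value_set (c : bool) : set R := if c then [set 1%R] else ~` [set 1%R].

Let measurable_value_set c : measurable (value_set c).
Proof. by rewrite /value_set; case: c => //; exact: measurableC. Qed.

Let patternE m b (J : {fset nat}) : (forall i, (i \in J) = (i < m)%N) ->
  pattern m b = \bigcap_(i in [set` J]) xi i @^-1` value_set (b i).
Proof.
move=> JE; apply/seteqP; split => w /= h i /=.
  rewrite JE => /h; rewrite /value_set; case: (b i); first by move/eqP.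
  by move/negbT/eqP.
move=> im; have := h i; rewrite /= JE => /(_ im).
by rewrite /value_set; case: (b i) => /=; [move=> ->; rewrite eqxx|move/eqP/negbTE].
Qed.

Lemma sigma_seq_pattern m b : sigma_seq xi (pattern m b).
Proof.
have [J [JE _]] := exists_fset_ltn m (cst 0).
by rewrite (patternE _ JE); exact: sigma_seq_bigcap.
Qed.

Lemma P_pattern m b :
  P (pattern m b) = (\prod_(i < m) (if b i then p1 else p2))%R%:E.
Proof.
have [J [JE JF]] := exists_fset_ltn m (fun i => P (xi i @^-1` value_set (b i))).
rewrite (patternE _ JE) mutually_independent_preimage// JF -prodEFin.
apply: eq_bigr => i _; rewrite /value_set; case: (b i) => /=; first exact: xi_1.
rewrite -preimage_setC probability_setC.
  by rewrite [X in 1 - X]xi_1 p2E EFinB.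
by rewrite -[X in measurable X]setTI; exact: measurable_funPT.
Qed.

End bernoulli_pattern.

End crossing_events.

(** * Countable decomposition of an event with finite refinements *)

Section decomposition.
Context {d : measure_display} {T : measurableType d} {R : realType}.
Variable P : probability T R.
Local Open Scope ereal_scope.

Lemma measure_finite_partition (I : finType) (c : T -> I) (G : set T) :
  measurable G -> (forall i, measurable [set w | c w = i]) ->
  P G = \sum_(i : I) P (G `&` [set w | c w = i]).
Proof.
move=> mG mc; have -> : P G = P (\bigcup_i (G `&` [set w | c w = i])).
  congr (P _).
  by apply/seteqP; split => w; [move=> Gw; exists (c w)|move=> [i _ []]].
have IE : [set: I] = [set` enum I].
  by apply/seteqP; split => i //= _; rewrite mem_enum.
rewrite measure_fin_bigcup//; last 3 first.
- exact: finite_finset.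
- by move=> i j _ _ [w [[_ <-] [_ <-]]].
- by move=> i _; exact: measurableI.
by rewrite IE -fsbig_seq ?enum_uniq// big_enum.
Qed.

(** The index type depends on n since a configuration of the first n off-periods is a subset of
    ['I_n]. The negligible set [N] makes room for paths on which no period contains t. *)
Lemma P_decomposition (I : nat -> finType) (c : forall n, T -> I n)
    (D : nat -> set T) (E N : set T) :
  measurable E -> (forall n, measurable (D n)) -> trivIset setT D ->
  (forall n i, measurable [set w | c n w = i]) ->
  P.-negligible N -> E `<=` \bigcup_n D n `|` N ->
  P E = \sum_(n <oo) \sum_(i : I n) P (E `&` D n `&` [set w | c n w = i]).
Proof.
move=> mE mD tD mc [M [mM M0 NM]] EDN.
have mED : measurable (\bigcup_n (E `&` D n)).
  by apply: bigcupT_measurable => n; exact: measurableI.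
transitivity (P (\bigcup_n (E `&` D n))).
  rewrite -setI_bigcupr in mED *.
  apply/eqP; rewrite eq_le; apply/andP; split; last first.
    by apply: le_measure; rewrite ?inE//; exact: subIsetl.
  apply: (@le_trans _ _ (P ((E `&` \bigcup_n D n) `|` M))).
    apply: le_measure; rewrite ?inE//; first exact: measurableU.
    by move=> w Ew; have [Dw|/NM] := EDN _ Ew; [left|right].
  by rewrite -[leRHS]adde0 -M0; exact: measureU2.
rewrite measure_semi_bigcup//; last 2 first.
- by move=> n; exact: measurableI.
- exact: trivIset_setIl.
apply: eq_eseriesr => n _; apply: measure_finite_partition => //.
exact: measurableI.
Qed.

End decomposition.

(** * Divergence of the switching times *)

Section explosion.
Context {d : measure_display} {T : measurableType d} {R : realType}.
Variables (P : probability T R) (U : nat -> {RV P >-> R}).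
Variables (F : cumulativeBounded (0 : R) (1 : R)) (f : R -> R).
Hypothesis U_indep : mutually_independent P (fun k => sigma_RV (U k)).
Hypothesis U_ge0 : forall k w, 0 <= U k w.
Hypothesis U_cdf : forall k, has_cdf (U k) F.
Hypothesis U_pdf : forall k, has_pdf (U k) f.

Lemma bounded_series_eventually_le (u : nat -> R) (a t : R) :
  (forall i, 0 <= u i) -> 0 < a -> (forall n, \sum_(0 <= i < n) u i <= t) ->
  exists m, forall i, (m <= i)%N -> u i <= a.
Proof.
move=> u0 a0 ut; apply: contrapT => /forallNP h.
have big k : exists n, a *+ k <= \sum_(0 <= i < n) u i.
  elim: k => [|k [n IH]]; first by exists 0%N; rewrite big_nil mulr0n.
  have /existsNP[i /not_implyP[ni /negP]] := h n; rewrite -ltNge => ai.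
  exists i.+1; rewrite big_nat_recr//= mulrSr lerD ?(ltW ai)//.
  rewrite (big_cat_nat _ ni)//= (le_trans IH)// lerDl.
  by apply: sumr_ge0.
(* One more than the integer part of t / a: that many terms above a push the partial sum beyond
   t. *)
have [n nt] := big (Num.truncn (t / a)).+1.
have := le_trans nt (ut n); rewrite -mulr_natl -ler_pdivlMr// leNgt.
by rewrite truncnS_gt.
Qed.

(** A non-negative variable with a density has no mass on the half-line up to 0, so F 0 = 0, and
    right continuity keeps F below 1 just to the right of 0. *)
Lemma cdf_nonneg_lt1 : exists2 a : R, 0 < a & F a < 1.
Proof.
have F0 : F 0 = 0.
  apply/eqP; rewrite -eqe -(U_cdf 0); apply/eqP.
  have [mf f0 fE] := U_pdf 0.
  transitivity (P (U 0%N @^-1` [set 0])).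
    congr (P _); apply/seteqP; split => w /=; rewrite in_itv/=; last by move=> ->.
    by move=> U0; apply/le_anti; rewrite U0 U_ge0.
  rewrite -[LHS]/(distribution P (U 0%N) [set 0]) fE// null_set_integral//.
    by apply/measurable_EFinP; exact: measurable_funTS.
  exact: lebesgue_measure_set1.
have Fc : F a @[a --> (0 : R)^'+] --> (0 : R).
  by rewrite -[X in _ --> X]F0; exact: (cumulative_is_right_continuous F).
have [] := @filter_ex _ (0 : R)^'+ _ (fun a => 0 < a /\ F a < 1).
  near=> a; split; near: a; first exact: nbhs_right_gt.
  by apply: (cvgr_lt 0 Fc); exact: ltr01.
by move=> a [a0 Fa]; exists a.
Unshelve. all: by end_near. Qed.

Lemma P_explosion t :
  P.-negligible [set w | forall n, \sum_(0 <= i < n) U i w <= t].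
Proof.
have [a a0 Fa] := cdf_nonneg_lt1.
(* On [E m] every on-period from index m on is at most a. By [bounded_series_eventually_le] these
   countably many events cover the paths with bounded sums. *)
pose E m := \bigcap_(i in [set i | (m <= i)%N]) U i @^-1` `]-oo, a].
have mU i : measurable (U i @^-1` `]-oo, a]).
  by rewrite -[X in measurable X]setTI; exact: measurable_funPT.
have mE m : measurable (E m) by apply: bigcap_measurableType => i _.
apply: (@negligibleS _ _ _ _ (\bigcup_m E m)).
  move=> w /= ut.
  have [m hm] := bounded_series_eventually_le (fun i => U_ge0 i w) a0 ut.
  by exists m => // i /= mi; rewrite in_itv/=; exact: hm.
apply: negligible_bigcup => m; exists (E m); split => //.
have EF M : (P (E m) <= (F a ^+ M)%:E)%E.
  (* The first m coordinates are left free, so the product over m + M coordinates is the M-th power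
     of F(a), with M arbitrary. *)
  pose C i : set R := if (i < m)%N then setT else `]-oo, a]%classic.
  have mC i : measurable (C i) by rewrite /C; case: ifP.
  have [J [JE JF]] := exists_fset_ltn (m + M) (fun i => P (U i @^-1` C i)).
  have -> : ((F a ^+ M)%:E = \prod_(i <- J) P (U i @^-1` C i))%E.
    rewrite JF big_split_ord/= big1 ?mul1e => [|i _]; last first.
      by rewrite /C ltn_ord preimage_setT probability_setT.
    rewrite (eq_bigr (fun=> (F a)%:E)) => [|i _]; last first.
      by rewrite /C ltnNge leq_addr /=; exact: U_cdf.
    by rewrite prodEFin prodr_const card_ord.
  rewrite -mutually_independent_preimage//; apply: le_measure; rewrite ?inE//.
    exact: measurable_bigcap_preimage.
  move=> w Ew i _; rewrite /C; case: ltnP => // mi; exact: Ew.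
have Efin : P (E m) = (fine (P (E m)))%:E by rewrite fineK// fin_num_measure.
suff : (P (E m) <= 0)%E by move=> E0; apply/eqP; rewrite eq_le E0 measure_ge0.
rewrite Efin lee_fin leNgt; apply/negP => E0.
have F0 : 0 <= F a by exact: has_cdf_ge0 (U_cdf 0).
have Fcvg : (F a ^+ n @[n --> \oo] --> (0 : R))%R by apply: cvg_expr; rewrite ger0_norm.
have [M _ /(_ M (leqnn _))] := cvgr_lt 0 Fcvg _ E0.
by rewrite ltNge -lee_fin -Efin => /negP; apply; exact: EF.
Qed.

End explosion.

(** * Densities given by double series, and sums over subsets *)

Section density_series.
Context {R : realType}.
Local Notation mu := (@lebesgue_measure R).
Local Open Scope ereal_scope.

Lemma eseries_from (f : nat -> \bar R) m : (forall n, (n < m)%N -> f n = 0) ->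
  \sum_(m <= n <oo) f n = \sum_(0 <= n <oo) f n.
Proof.
move=> f0; rewrite eseries_cond eseries_mkcond; apply: eq_eseriesr => n _ /=.
by case: leqP => // /f0 ->.
Qed.

(** Non-negativity lets the integral pass through the series. The formula for [nu] starts at n = 0
    because the decomposition runs over all n; for n < m the inner sum is empty. *)
Lemma is_density_on_series (D : set R) (nu : set R -> \bar R) m
    (p : nat -> nat -> R -> \bar R) : measurable D ->
  (forall n k, (m <= k <= n)%N -> measurable_fun setT (p n k)) ->
  (forall n k s, (m <= k <= n)%N -> 0 <= p n k s) ->
  (forall B, measurable B -> B `<=` D ->
    nu B = \sum_(0 <= n <oo) \sum_(m <= k < n.+1) \int[mu]_(s in B) p n k s) ->
  is_density_on D nu (fun s => \sum_(m <= n <oo) \sum_(m <= k < n.+1) p n k s).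
Proof.
move=> mD mp p0 nuE.
(* The terms are controlled only for m <= k <= n; with m = 1 this avoids the meaningless
   [pdf_convn f 0]. Extension by 0 gives measurability and sign for all indices. *)
pose q n k := if (m <= k <= n)%N then p n k else cst 0.
have mq n k : measurable_fun setT (q n k).
  by rewrite /q; case: ifP => [/mp//|_]; exact: measurable_cst.
have q0 n k s : 0 <= q n k s by rewrite /q; case: ifP => // /p0.
have pq n s : \sum_(m <= k < n.+1) p n k s = \sum_(m <= k < n.+1) q n k s.
  by apply: eq_big_nat => k mk; rewrite /q mk.
have -> : (fun s => \sum_(m <= n <oo) \sum_(m <= k < n.+1) p n k s) =
    (fun s => \sum_(0 <= n <oo) \sum_(m <= k < n.+1) q n k s).
  apply/funext => s; rewrite eseries_from; last by move=> n nm; rewrite big_geq.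
  by apply: eq_eseriesr => n _.
have mg n : measurable_fun setT (fun s => \sum_(m <= k < n.+1) q n k s).
  exact: emeasurable_sum.
have g0 n s : 0 <= \sum_(m <= k < n.+1) q n k s by apply: sume_ge0.
split.
- by apply: measurable_funTS; apply: ge0_emeasurable_sum.
- by move=> s _; apply: nneseries_ge0 => n _ _; exact: g0.
- move=> B mB BD; rewrite nuE// integral_nneseries//; last by move=> n; apply: measurable_funTS; exact: mg.
  apply: eq_eseriesr => n _; rewrite ge0_integral_sum//; last by move=> k; apply: measurable_funTS; exact: mq.
  by apply: eq_big_nat => k mk; rewrite /q mk.
Qed.

Lemma sum_by_card n (F : nat -> \bar R) :
  \sum_(e : {set 'I_n}) F #|e| = \sum_(0 <= k < n.+1) 'C(n, k)%:R%:E * F k.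
Proof.
have cardn (e : {set 'I_n}) : (#|e| < n.+1)%N.
  by rewrite ltnS -[X in (_ <= X)%N]card_ord max_card.
rewrite (partition_big (fun e => Ordinal (cardn e)) xpredT)//= big_mkord.
apply: eq_bigr => k _.
rewrite (eq_bigl (fun e : {set 'I_n} => e \in [set e : {set 'I_n} | #|e| == k]%SET)).
  rewrite (eq_bigr (fun=> F k)) => [|e]; last by rewrite inE => /eqP ->.
  by rewrite big_const card_draws card_ord mule_natl /enatmul Monoid.iteropE.
by move=> e; rewrite inE -val_eqE.
Qed.

Lemma integral_coef (c q : R) (h g : R -> \bar R) (B : set R) : measurable B ->
  (0 <= c * q)%R -> measurable_fun setT h -> measurable_fun setT g ->
  (forall s, 0 <= h s) -> (forall s, 0 <= g s) ->
  c%:E * (\int[mu]_(s in B) (h s * g s) * q%:E) =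
  \int[mu]_(s in B) ((c * q)%R%:E * h s * g s).
Proof.
move=> mB cq0 mh mg h0 g0.
rewrite muleCA -EFinM muleC -ge0_integralZl//.
- by apply: eq_integral => s _; rewrite muleA.
- by apply: measurable_funTS; exact: emeasurable_funM.
- by move=> s _; exact: mule_ge0.
Qed.

End density_series.

(** * Law of the occupation time *)

Section onoff_distribution.
Context {d : measure_display} {T : measurableType d} {R : realType}.
Variables (P : probability T R) (U S L xi : nat -> {RV P >-> R}).
Variables (F_U F_S F_L : cumulativeBounded (0 : R) (1 : R)) (f_U f_S f_L : R -> R).
Variables (p1 p2 : R).
Hypothesis U_ge0 : forall k w, 0 <= U k w.
Hypothesis S_ge0 : forall k w, 0 <= S k w.
Hypothesis L_ge0 : forall k w, 0 <= L k w.
Hypothesis U_indep : mutually_independent P (fun k => sigma_RV (U k)).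
Hypothesis S_indep : mutually_independent P (fun k => sigma_RV (S k)).
Hypothesis L_indep : mutually_independent P (fun k => sigma_RV (L k)).
Hypothesis xi_indep : mutually_independent P (fun k => sigma_RV (xi k)).
Hypothesis indep : mutually_independent P
  (fun j : 'I_4 => sigma_seq (tnth [tuple U; S; L; xi] j)).
Hypothesis U_cdf : forall k, has_cdf (U k) F_U.
Hypothesis U_pdf : forall k, has_pdf (U k) f_U.
Hypothesis S_cdf : forall k, has_cdf (S k) F_S.
Hypothesis S_pdf : forall k, has_pdf (S k) f_S.
Hypothesis L_cdf : forall k, has_cdf (L k) F_L.
Hypothesis L_pdf : forall k, has_pdf (L k) f_L.
Hypothesis p1_gt0 : 0 < p1.
Hypothesis p2E : p2 = 1 - p1.
Hypothesis xi_1 : forall k, P [set w | xi k w = 1] = p1%:E.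
Variable t : R.
Hypothesis t_ge0 : 0 <= t.
Local Notation mu := (@lebesgue_measure R).
Local Notation tau := (switch_time U S L xi).
Local Notation period := (in_period U S L xi).
Local Notation X := (onoff_process U S L xi t).
Local Notation St := (occupation_time U S L xi 1 t).
Local Notation rest := (rest_time U L).
Local Notation cfg := (config xi).
Local Notation G n m := (cdf_conv_pow F_U n F_L m).

Let p1_ge0 : 0 <= p1. Proof. exact: ltW. Qed.

Let p2_ge0 : 0 <= p2.
Proof.
rewrite p2E subr_ge0 -lee_fin -(xi_1 0); apply: probability_le1.
exact: measurable_xi_eq1.
Qed.

Lemma rest_cdf n l : uniq l -> has_cdf (rest n l) (G n (size l)).
Proof.
move=> ul; rewrite /cdf_conv_pow.
rewrite -[X in cdf_convn F_U X](size_iota 0).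
apply: (@cdf_conv_indep _ _ _ P (rv_sum U (iota 0 n)) (rv_sum L l)) => //.
- exact: rv_sum_UL_indep indep _ _.
- exact: (has_cdf_rv_sum U_indep U_cdf (iota_uniq 0 n)).
- exact: (has_cdf_rv_sum L_indep L_cdf ul).
Qed.

Lemma rest_density n l : uniq l ->
  has_density (rest n.+1 l) (pdf_conv_pow f_U n.+1 f_L (size l)).
Proof.
have Ud : has_density (P := P) (rv_sum U (iota 0 n.+1)) (pdf_convn f_U n.+1).
  rewrite -[X in pdf_convn f_U X](size_iota 0).
  exact: (has_density_rv_sum U_indep U_pdf _ (iota_uniq 0 n.+1)).
(* By definition [pdf_conv_pow] with second exponent 0 is the first factor alone, so the empty list
   involves no convolution. *)
case: l => [_|i l ul].
  have [mh h0 hE] := Ud; split => // B mB; rewrite -hE//.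
  congr (P (_ @^-1` B)); apply/funext => w.
  by rewrite rest_timeE rv_sum_nil addr0; exact/esym/rv_sum_iota.
rewrite /pdf_conv_pow/=.
apply: (@density_conv_indep _ _ _ P (rv_sum U (iota 0 n.+1)) (rv_sum L (i :: l))) => //.
- exact: rv_sum_UL_indep indep _ _.
- exact: (has_density_rv_sum L_indep L_pdf _ ul).
Qed.

(** Cdfs are compared through variables that have them: one more on-period can only increase the
    sum. This makes the brackets of the series non-negative. *)
Lemma cdf_conv_powS_le n m r : G n.+1 m r <= G n m r.
Proof.
rewrite -(size_iota 0 m).
apply: (has_cdf_le r (rest_cdf n (iota_uniq 0 m)) (rest_cdf n.+1 (iota_uniq 0 m))).
exact: rest_time_le.
Qed.

Lemma cdf_conv_pow_leS n m r : G n m.+1 r <= G n m r.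
Proof.
(* The lists [iota 1 m] and [iota 0 m.+1] differ by the head 0 only, so the pointwise comparison for
   an added index applies. *)
rewrite -[in G n m](size_iota 1 m) -(size_iota 0 m.+1).
apply: (has_cdf_le r (rest_cdf n (iota_uniq 1 m)) (rest_cdf n (iota_uniq 0 m.+1))).
exact: rest_time_cons_le.
Qed.

Lemma cdf_convn_leS k r : cdf_convn F_S k.+1 r <= cdf_convn F_S k r.
Proof.
rewrite -[in cdf_convn F_S k](size_iota 1 k) -(size_iota 0 k.+1).
apply: (has_cdf_le r (has_cdf_rv_sum S_indep S_cdf (iota_uniq 1 k))
  (has_cdf_rv_sum S_indep S_cdf (iota_uniq 0 k.+1))).
by move=> w; rewrite /= rv_sum_cons lerDr.
Qed.

(** * Probabilities of the configurations of types *)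

Lemma config_patternE n (e : {set 'I_n}) :
  [set w | cfg n w = e] = pattern xi n (fun i => i \in ord_seq e).
Proof. by apply/seteqP; split => w /= /configP. Qed.

(** The type of the current off-period is one more bit, at position n; the longer pattern absorbs it
    and supplies the extra factor p1. *)
Lemma config_patternS1 n (e : {set 'I_n}) :
  [set w | cfg n w = e /\ xi n w = 1] = pattern xi n.+1 (fun i => i \in n :: ord_seq e).
Proof.
apply/seteqP; split => w /=.
- move=> [/configP ew xi1] i; rewrite ltnS leq_eqVlt in_cons => /orP[/eqP ->|iltn].
    by rewrite eqxx xi1 eqxx.
  by rewrite ew// (ltn_eqF iltn).
- move=> ew; split; last by apply/eqP; rewrite ew// in_cons eqxx.
  by apply/configP => i iltn; rewrite ew ?(leqW iltn)// in_cons (ltn_eqF iltn).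
Qed.

Lemma config_patternS2 n (e : {set 'I_n}) :
  [set w | cfg n w = e /\ xi n w <> 1] = pattern xi n.+1 (fun i => i \in ord_seq e).
Proof.
apply/seteqP; split => w /=.
- move=> [/configP ew /eqP xi1] i; rewrite ltnS leq_eqVlt => /orP[/eqP ->|iltn].
    by rewrite (negbTE (ord_seq_notin e)) (negbTE xi1).
  exact: ew.
- move=> ew; split; last first.
    by apply/eqP; rewrite ew// (negbTE (ord_seq_notin e)).
  by apply/configP => i iltn; rewrite ew// leqW.
Qed.

Lemma prod_config n (e : {set 'I_n}) :
  \prod_(i < n) (if val i \in ord_seq e then p1 else p2) =
  p1 ^+ #|e| * p2 ^+ (n - #|e|).
Proof.
have memE (i : 'I_n) : (val i \in ord_seq e) = (i \in e).
  by rewrite mem_map ?mem_enum//; exact: val_inj.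
rewrite (eq_bigr (fun i => if i \in e then p1 else p2)) => [|i _]; last by rewrite memE.
rewrite (bigID (fun i => i \in e))/=; congr (_ * _).
  by rewrite (eq_bigr (fun=> p1)) ?prodr_const// => i ->.
rewrite (eq_bigr (fun=> p2)) => [|i /negbTE ->//].
rewrite (eq_bigl (fun i => i \in ~: e)) => [|i]; last by rewrite inE.
by rewrite prodr_const cardsCs finset.setCK card_ord.
Qed.

Lemma P_config n (e : {set 'I_n}) : P [set w | cfg n w = e] =
  (p1 ^+ #|e| * p2 ^+ (n - #|e|))%:E.
Proof. by rewrite config_patternE (P_pattern xi_indep p2E xi_1) prod_config. Qed.

Lemma P_config1 n (e : {set 'I_n}) : P [set w | cfg n w = e /\ xi n w = 1] =
  (p1 ^+ #|e|.+1 * p2 ^+ (n - #|e|))%:E.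
Proof.
rewrite config_patternS1 (P_pattern xi_indep p2E xi_1) big_ord_recr/=.
rewrite in_cons eqxx/= exprS -mulrA [in RHS]mulrC.
rewrite -prod_config; congr (_ * _)%:E; apply: eq_bigr => i _.
by rewrite in_cons (ltn_eqF (ltn_ord i)).
Qed.

Lemma P_config2 n (e : {set 'I_n}) : P [set w | cfg n w = e /\ xi n w <> 1] =
  (p1 ^+ #|e| * p2 ^+ (n - #|e|).+1)%:E.
Proof.
rewrite config_patternS2 (P_pattern xi_indep p2E xi_1) big_ord_recr/=.
by rewrite (negbTE (ord_seq_notin e)) prod_config exprSr mulrA.
Qed.

Lemma card_setC_ord n (e : {set 'I_n}) : #|~: e| = (n - #|e|)%N.
Proof. by rewrite cardsCs finset.setCK card_ord. Qed.


(** * Splitting the event of each state over periods and configurations *)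

Definition onoff_event (B : set R) j : set T := [set w | B (St w) /\ X w = j].
Local Notation ev := onoff_event.

Let lseq n (e : {set 'I_n}) := ord_seq (~: e).

Let on_period n : set T := [set w | period n.*2 t w].
Let off1_period n : set T := [set w | period n.*2.+1 t w /\ xi n w = 1].
Let off2_period n : set T := [set w | period n.*2.+1 t w /\ xi n w <> 1].

Lemma measurable_onoff_event B j : measurable B -> measurable (ev B j).
Proof.
move=> mB; rewrite (_ : ev B j = St @^-1` B `&` [set w | X w = j])//.
apply: measurableI; last exact: measurable_onoff.
rewrite -[X in measurable X]setTI.
exact: (measurable_occupation_time xi U_ge0 S_ge0 L_ge0 t).
Qed.

Let measurable_config n (e : {set 'I_n}) : measurable [set w | cfg n w = e].
Proof.
rewrite config_patternE; apply: sigma_seq_measurable; exact: sigma_seq_pattern.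
Qed.

Lemma trivIset_period (D : nat -> set T) (c : nat -> nat) : injective c ->
  (forall n w, D n w -> period (c n) t w) -> trivIset setT D.
Proof.
move=> cinj Dc m n _ _ [w [Dm Dn]]; apply: cinj.
exact: (in_period_inj U_ge0 S_ge0 L_ge0 (Dc _ _ Dm) (Dc _ _ Dn)).
Qed.

(** State 0 contains the paths with the conventional value; they satisfy the bound of [P_explosion],
    which supplies the negligible set. *)
Lemma P_on_event B : measurable B -> P (ev B 0) =
  (\sum_(0 <= n <oo) \sum_(e : {set 'I_n})
    P (ev B 0 `&` on_period n `&` [set w | cfg n w = e]))%E.
Proof.
move=> mB; apply: (P_decomposition (I := fun n => {set 'I_n} : finType)
  (N := [set w | forall n, \sum_(0 <= i < n) U i w <= t])).
- exact: measurable_onoff_event.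
- by move=> n; exact: measurable_in_period.
- by apply: (trivIset_period (c := double)) => // m n; exact: double_inj.
- by move=> n e; exact: measurable_config.
- exact: P_explosion U_indep U_ge0 U_cdf U_pdf t.
- move=> w [_ /(onoff_eq0_on U_ge0 S_ge0 L_ge0)[[n tn]|tn]]; first by left; exists n.
  right => n /=; have [[m tm]|] := in_period_or_above U S L xi w t_ge0.
    by have := tn m; rewrite tm.
  (* The switching time of index 2n dominates the sum of the first n on-periods. *)
  move=> /(_ n.*2); apply: le_trans; rewrite switch_time_config.
  rewrite rv_sum_iota big_mkord addrCA lerDl addr_ge0// rv_sum_ord_seq;
  exact: sumr_ge0.
Qed.

(** State 1 is assumed only inside an off-period, never by convention, so the exceptional set is
    empty. *)
Lemma P_off1_event B : measurable B -> P (ev B 1) =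
  (\sum_(0 <= n <oo) \sum_(e : {set 'I_n})
    P (ev B 1 `&` off1_period n `&` [set w | cfg n w = e]))%E.
Proof.
move=> mB; apply: (P_decomposition (I := fun n => {set 'I_n} : finType) (N := set0)).
- exact: measurable_onoff_event.
- move=> n; apply: measurableI; first exact: measurable_in_period.
  exact: measurable_xi_eq1.
- by apply: (trivIset_period (c := fun n => n.*2.+1)) => [m n []|n w []//]; exact: double_inj.
- by move=> n e; exact: measurable_config.
- exact: negligible_set0.
- by move=> w [_ /(onoff_eq1 xi U_ge0 S_ge0 L_ge0)[n tn]]; left; exists n.
Qed.

Lemma P_off2_event B : measurable B -> P (ev B 2) =
  (\sum_(0 <= n <oo) \sum_(e : {set 'I_n})
    P (ev B 2 `&` off2_period n `&` [set w | cfg n w = e]))%E.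
Proof.
move=> mB; apply: (P_decomposition (I := fun n => {set 'I_n} : finType) (N := set0)).
- exact: measurable_onoff_event.
- move=> n; apply: measurableI; first exact: measurable_in_period.
  by apply: measurableC; exact: measurable_xi_eq1.
- by apply: (trivIset_period (c := fun n => n.*2.+1)) => [m n []|n w []//]; exact: double_inj.
- by move=> n e; exact: measurable_config.
- exact: negligible_set0.
- by move=> w [_ /(onoff_eq2 xi U_ge0 S_ge0 L_ge0)[n tn]]; left; exists n.
Qed.

(** Fixing the configuration replaces the random lists by those of [e], which gives the event the
    shape required by [P_density_crossing]. *)
Lemma on_event_config B n (e : {set 'I_n}) (Z := rv_sum S (ord_seq e)) :
  ev B 0 `&` on_period n `&` [set w | cfg n w = e] =
  Z @^-1` B `&`
  [set w | Z w + rest n (lseq e) w <= t < Z w + rest n.+1 (lseq e) w] `&`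
  [set w | cfg n w = e].
Proof.
apply/seteqP; split => w [[]] /=.
- move=> [+ _] tn ew; rewrite (occupation_time_on_config U_ge0 S_ge0 L_ge0 t_ge0 tn).
  by move: tn; rewrite /on_period/= in_period_onE ew.
- move=> BZ tn ew.
  have tn' : period n.*2 t w by rewrite in_period_onE ew.
  do 3?split => //; last exact: onoff_on tn'.
  by rewrite (occupation_time_on_config U_ge0 S_ge0 L_ge0 t_ge0 tn') ew.
Qed.

Lemma off2_event_config B n (e : {set 'I_n}) (Z := rv_sum S (ord_seq e)) :
  ev B 2 `&` off2_period n `&` [set w | cfg n w = e] =
  Z @^-1` B `&`
  [set w | Z w + rest n.+1 (lseq e) w <= t < Z w + rest n.+1 (n :: lseq e) w] `&`
  [set w | cfg n w = e /\ xi n w <> 1].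
Proof.
apply/seteqP; split => w [[]] /=.
- move=> [+ _] [tn xi1] ew.
  rewrite (occupation_time_off2_config U_ge0 S_ge0 L_ge0 t_ge0 tn xi1).
  by move: tn; rewrite in_period_off2E// ew.
- move=> BZ tn [ew xi1].
  have tn' : period n.*2.+1 t w by rewrite in_period_off2E// ew.
  do 3?split => //; last by apply/(onoff_eq2 xi U_ge0 S_ge0 L_ge0); exists n.
  by rewrite (occupation_time_off2_config U_ge0 S_ge0 L_ge0 t_ge0 tn' xi1) ew.
Qed.

(** The occupation time is t minus the density variable [Y], so [B] is pulled back along the
    reflection at t. *)
Lemma off1_event_config B n (e : {set 'I_n}) (Y := rest n.+1 (lseq e)) :
  ev B 1 `&` off1_period n `&` [set w | cfg n w = e] =
  Y @^-1` ((fun y => t - y) @^-1` B) `&`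
  [set w | Y w + rv_sum S (ord_seq e) w <= t < Y w + rv_sum S (n :: ord_seq e) w] `&`
  [set w | cfg n w = e /\ xi n w = 1].
Proof.
apply/seteqP; split => w [[]] /=.
- move=> [+ _] [tn xi1] ew.
  rewrite (occupation_time_off1_config U_ge0 S_ge0 L_ge0 t_ge0 tn xi1).
  by move: tn; rewrite in_period_off1E// ew.
- move=> BZ tn [ew xi1].
  have tn' : period n.*2.+1 t w by rewrite in_period_off1E// ew.
  do 3?split => //; last by apply/(onoff_eq1 xi U_ge0 S_ge0 L_ge0); exists n.
  by rewrite (occupation_time_off1_config U_ge0 S_ge0 L_ge0 t_ge0 tn' xi1) ew.
Qed.


(** * Contribution of a single configuration *)

Let sigma_config n (e : {set 'I_n}) : sigma_seq xi [set w | cfg n w = e].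
Proof. by rewrite config_patternE; exact: sigma_seq_pattern. Qed.

Let sigma_config1 n (e : {set 'I_n}) :
  sigma_seq xi [set w | cfg n w = e /\ xi n w = 1].
Proof. by rewrite config_patternS1; exact: sigma_seq_pattern. Qed.

Let sigma_config2 n (e : {set 'I_n}) :
  sigma_seq xi [set w | cfg n w = e /\ xi n w <> 1].
Proof. by rewrite config_patternS2; exact: sigma_seq_pattern. Qed.

Lemma off1_time_density n (e : {set 'I_n}) : e != finset.set0 ->
  has_density (P := P) (rv_sum S (ord_seq e)) (pdf_convn f_S #|e|).
Proof.
move=> e0; rewrite -size_ord_seq.
apply: (has_density_rv_sum S_indep S_pdf _ (ord_seq_uniq e)).
by rewrite -size_eq0 size_ord_seq cards_eq0.
Qed.

Lemma rest_cdf_config n m (e : {set 'I_n}) :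
  has_cdf (rest m (lseq e)) (G m (n - #|e|)).
Proof. by rewrite -card_setC_ord -size_ord_seq; exact: rest_cdf (ord_seq_uniq _). Qed.

Lemma rest_cdf_configS n m (e : {set 'I_n}) :
  has_cdf (rest m (n :: lseq e)) (G m (n - #|e|).+1).
Proof.
rewrite -card_setC_ord -size_ord_seq.
exact: (rest_cdf m (ord_seq_cons_uniq (~: e))).
Qed.

Lemma P_on_config B n (e : {set 'I_n}) : measurable B -> e != finset.set0 ->
  P (ev B 0 `&` on_period n `&` [set w | cfg n w = e]) =
  (\int[mu]_(s in B) (pdf_convn f_S #|e| s *
      (G n (n - #|e|) (t - s) - G n.+1 (n - #|e|) (t - s))%:E) *
   (p1 ^+ #|e| * p2 ^+ (n - #|e|))%:E)%E.
Proof.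
move=> mB e0; rewrite on_event_config -P_config.
apply: (P_density_crossing t _ _ _ (off1_time_density e0) (rest_cdf_config n e)
  (rest_cdf_config n.+1 e) _ mB).
- exact: measurable_config.
- exact: (rest_time_indep indep n (lseq e) (ord_seq e) (sigma_config e)).
- exact: (rest_time_indep indep n.+1 (lseq e) (ord_seq e) (sigma_config e)).
- by move=> w; exact: rest_time_le.
Qed.

Lemma P_off2_config B n (e : {set 'I_n}) : measurable B -> e != finset.set0 ->
  P (ev B 2 `&` off2_period n `&` [set w | cfg n w = e]) =
  (\int[mu]_(s in B) (pdf_convn f_S #|e| s *
      (G n.+1 (n - #|e|) (t - s) - G n.+1 (n - #|e|).+1 (t - s))%:E) *
   (p1 ^+ #|e| * p2 ^+ (n - #|e|).+1)%:E)%E.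
Proof.
move=> mB e0; rewrite off2_event_config -P_config2.
apply: (P_density_crossing t _ _ _ (off1_time_density e0) (rest_cdf_config n.+1 e)
  (rest_cdf_configS n.+1 e) _ mB).
- exact: sigma_seq_measurable (sigma_config2 e).
- exact: (rest_time_indep indep n.+1 (lseq e) (ord_seq e) (sigma_config2 e)).
- exact: (rest_time_indep indep n.+1 (n :: lseq e) (ord_seq e) (sigma_config2 e)).
- by move=> w; exact: rest_time_cons_le.
Qed.

(** The density comes from [rest n.+1], which contains at least one on-period whatever [e] is. *)
Lemma P_off1_config B n (e : {set 'I_n}) : measurable B ->
  P (ev B 1 `&` off1_period n `&` [set w | cfg n w = e]) =
  (\int[mu]_(s in B) (pdf_conv_pow f_U n.+1 f_L (n - #|e|) (t - s)%R *
      (cdf_convn F_S #|e| s - cdf_convn F_S #|e|.+1 s)%:E) *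
   (p1 ^+ #|e|.+1 * p2 ^+ (n - #|e|))%:E)%E.
Proof.
move=> mB; rewrite off1_event_config -P_config1.
have Yd : has_density (rest n.+1 (lseq e)) (pdf_conv_pow f_U n.+1 f_L (n - #|e|)).
  by rewrite -card_setC_ord -size_ord_seq; exact: rest_density (ord_seq_uniq _).
have S1 : has_cdf (P := P) (rv_sum S (ord_seq e)) (cdf_convn F_S #|e|).
  by rewrite -size_ord_seq; exact: (has_cdf_rv_sum S_indep S_cdf (ord_seq_uniq e)).
have S2 : has_cdf (P := P) (rv_sum S (n :: ord_seq e)) (cdf_convn F_S #|e|.+1).
  by rewrite -size_ord_seq; exact: (has_cdf_rv_sum S_indep S_cdf (ord_seq_cons_uniq e)).
have indepC c : indep_event [set w | cfg n w = e /\ xi n w = 1]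
    (rest n.+1 (lseq e)) (rv_sum S c).
  move=> C1 C2 mC1 mC2; rewrite [_ @^-1` C1 `&` _]setIC.
  rewrite (rest_time_indep indep n.+1 (lseq e) c (sigma_config1 e))//.
  by congr (_ * _)%E; exact: muleC.
have mtB : measurable ((fun y => t - y) @^-1` B).
  by rewrite -[X in measurable X]setTI; apply: measurable_funB.
have SS w : rv_sum S (ord_seq e) w <= rv_sum S (n :: ord_seq e) w.
  by rewrite rv_sum_cons lerDr.
rewrite (P_density_crossing t _ (indepC _) (indepC _) Yd S1 S2 SS mtB).
- congr (_ * _)%E; have [mh h0 _] := Yd.
  (* Substituting s = t - y turns the integral over the reflected set into one over [B]. *)
  rewrite -(@ge0_integral_reflect _ t B)//.
  + by apply: eq_integral => s _; rewrite subKr.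
  + apply: measurable_funTS; apply: emeasurable_funM.
      by apply: (measurableT_comp mh); exact: measurable_funB.
    apply/measurable_EFinP; apply: measurable_funB;
    exact: measurable_cumulativeBounded.
  + move=> s _; rewrite mule_ge0// lee_fin subr_ge0.
    exact: cdf_convn_leS.
- exact: sigma_seq_measurable (sigma_config1 e).
Qed.


(** * Densities of the occupation time on ]0, t[ *)

Let off1_sum_density k : (0 < k)%N ->
  has_density (P := P) (rv_sum S (iota 0 k)) (pdf_convn f_S k).
Proof.
move=> k0; rewrite -[X in pdf_convn f_S X](size_iota 0 k).
apply: (has_density_rv_sum S_indep S_pdf _ (iota_uniq 0 k)).
by case: k k0.
Qed.

Let measurable_shifted_cdf (F : cumulativeBounded (0 : R) (1 : R)) :
  measurable_fun setT (fun s : R => F (t - s)).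
Proof.
apply: (measurableT_comp (measurable_cumulativeBounded F)).
exact: measurable_funB.
Qed.

Let set0_sum n w : rv_sum S (ord_seq (finset.set0 : {set 'I_n})) w = 0.
Proof. by rewrite rv_sum_ord_seq big_pred0// => i; rewrite inE. Qed.

Lemma is_density_on_state0 :
  is_density_on `]0, t[ (fun B => P (ev B 0))
    (fun s => \sum_(1 <= n <oo) \sum_(1 <= k < n.+1)
       (('C(n, k)%:R * p1 ^+ k * p2 ^+ (n - k))%R%:E
        * pdf_convn f_S k s
        * (G n (n - k) (t - s) - G n.+1 (n - k) (t - s))%R%:E))%E.
Proof.
have coef0 n k : 0 <= 'C(n, k)%:R * p1 ^+ k * p2 ^+ (n - k) by rewrite !mulr_ge0 ?exprn_ge0.
have diff0 n k s : 0 <= G n (n - k) (t - s) - G n.+1 (n - k) (t - s).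
  by rewrite subr_ge0; exact: cdf_conv_powS_le.
have mdiff n k : measurable_fun setT
    (fun s : R => (G n (n - k) (t - s) - G n.+1 (n - k) (t - s))%:E).
  by apply/measurable_EFinP; exact: measurable_funB.
apply: is_density_on_series => [|n k /andP[k0 _]|n k s /andP[k0 _]|B mB Bt].
- exact: measurable_itv.
- have [mh _ _] := off1_sum_density k0.
  by do 2!apply: emeasurable_funM => //.
- have [_ h0 _] := off1_sum_density k0.
  by rewrite !mule_ge0// lee_fin.
rewrite P_on_event//; apply: eq_eseriesr => n _.
(* The value 0 at k = 0 is that of the empty configuration: there the off-1 time is 0, outside ]0,
   t[, while [pdf_convn f_S 0] has no meaning. *)
pose phi k := (if k == 0%N then 0 else
  \int[mu]_(s in B) (pdf_convn f_S k s *
    (G n (n - k) (t - s) - G n.+1 (n - k) (t - s))%R%:E) *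
  (p1 ^+ k * p2 ^+ (n - k))%R%:E)%E.
rewrite (eq_bigr (fun e : {set 'I_n} => phi #|e|)) => [|e _]; last first.
  rewrite /phi cards_eq0; case: eqP => [->|/eqP e0]; last exact: P_on_config.
  rewrite on_event_config (_ : _ @^-1` B = set0) ?set0I ?measure0//.
  apply/seteqP; split => w //=; rewrite set0_sum => /Bt.
  by rewrite /= in_itv/= ltxx.
rewrite sum_by_card big_ltn// {1}/phi eqxx mule0 add0e.
apply: eq_big_nat => k /andP[k0 _]; rewrite /phi gtn_eqF//.
have [mh h0 _] := off1_sum_density k0.
rewrite integral_coef//; first by apply: eq_integral => s _; rewrite mulrA.
  by rewrite mulrA.
by move=> s; rewrite lee_fin.
Qed.


(** All subsets contribute, the empty one included, since the density variable never degenerates;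
    hence both sums start at 0. *)
Lemma is_density_on_state1 :
  is_density_on `]0, t[ (fun B => P (ev B 1))
    (fun s => \sum_(0 <= n <oo) \sum_(0 <= k < n.+1)
       (('C(n, k)%:R * p1 ^+ k.+1 * p2 ^+ (n - k))%R%:E
        * pdf_conv_pow f_U n.+1 f_L (n - k) (t - s)%R
        * (cdf_convn F_S k s - cdf_convn F_S k.+1 s)%R%:E))%E.
Proof.
have coef0 n k : 0 <= 'C(n, k)%:R * p1 ^+ k.+1 * p2 ^+ (n - k).
  by rewrite !mulr_ge0 ?exprn_ge0.
have diff0 k s : 0 <= cdf_convn F_S k s - cdf_convn F_S k.+1 s.
  by rewrite subr_ge0; exact: cdf_convn_leS.
have mdiff k : measurable_fun setT
    (fun s : R => (cdf_convn F_S k s - cdf_convn F_S k.+1 s)%:E).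
  apply/measurable_EFinP; apply: measurable_funB;
  exact: measurable_cumulativeBounded.
have rd n k : has_density (rest n.+1 (iota 0 k)) (pdf_conv_pow f_U n.+1 f_L k).
  by rewrite -[X in pdf_conv_pow _ _ _ X](size_iota 0 k); exact: rest_density (iota_uniq _ _).
have mh n k : measurable_fun setT
    (fun s : R => pdf_conv_pow f_U n.+1 f_L k (t - s)).
  by have [mh _ _] := rd n k; apply: (measurableT_comp mh); exact: measurable_funB.
have h0 n k s : (0 <= pdf_conv_pow f_U n.+1 f_L k s)%E by have [_ h0 _] := rd n k.
apply: is_density_on_series => [|n k _|n k s _|B mB Bt].
- exact: measurable_itv.
- by do 2!apply: emeasurable_funM => //.
- by rewrite !mule_ge0// lee_fin.
rewrite P_off1_event//; apply: eq_eseriesr => n _.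
rewrite (eq_bigr _ (fun e _ => P_off1_config e mB)).
rewrite (sum_by_card n (fun k => (\int[mu]_(s in B)
    (pdf_conv_pow f_U n.+1 f_L (n - k) (t - s)%R *
      (cdf_convn F_S k s - cdf_convn F_S k.+1 s)%:E) *
   (p1 ^+ k.+1 * p2 ^+ (n - k))%:E)%E)).
apply: eq_big_nat => k _.
rewrite integral_coef//; first by apply: eq_integral => s _; rewrite mulrA.
  by rewrite mulrA.
by move=> s; rewrite lee_fin.
Qed.

(** As in state 0, except that t lies in an off-2 period: its type costs one more factor p2, and the
    longer sum gains an [L] rather than a [U]. *)
Lemma is_density_on_state2 :
  is_density_on `]0, t[ (fun B => P (ev B 2))
    (fun s => \sum_(1 <= n <oo) \sum_(1 <= k < n.+1)
       (('C(n, k)%:R * p1 ^+ k * p2 ^+ (n - k).+1)%R%:E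
        * pdf_convn f_S k s
        * (G n.+1 (n - k) (t - s) - G n.+1 (n - k).+1 (t - s))%R%:E))%E.
Proof.
have coef0 n k : 0 <= 'C(n, k)%:R * p1 ^+ k * p2 ^+ (n - k).+1.
  by rewrite !mulr_ge0 ?exprn_ge0.
have diff0 n k s : 0 <= G n.+1 (n - k) (t - s) - G n.+1 (n - k).+1 (t - s).
  by rewrite subr_ge0; exact: cdf_conv_pow_leS.
have mdiff n k : measurable_fun setT
    (fun s : R => (G n.+1 (n - k) (t - s) - G n.+1 (n - k).+1 (t - s))%:E).
  by apply/measurable_EFinP; exact: measurable_funB.
apply: is_density_on_series => [|n k /andP[k0 _]|n k s /andP[k0 _]|B mB Bt].
- exact: measurable_itv.
- have [mh _ _] := off1_sum_density k0.
  by do 2!apply: emeasurable_funM => //.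
- have [_ h0 _] := off1_sum_density k0.
  by rewrite !mule_ge0// lee_fin.
rewrite P_off2_event//; apply: eq_eseriesr => n _.
pose phi k := (if k == 0%N then 0 else
  \int[mu]_(s in B) (pdf_convn f_S k s *
    (G n.+1 (n - k) (t - s) - G n.+1 (n - k).+1 (t - s))%R%:E) *
  (p1 ^+ k * p2 ^+ (n - k).+1)%R%:E)%E.
rewrite (eq_bigr (fun e : {set 'I_n} => phi #|e|)) => [|e _]; last first.
  rewrite /phi cards_eq0; case: eqP => [->|/eqP e0]; last exact: P_off2_config.
  rewrite off2_event_config (_ : _ @^-1` B = set0) ?set0I ?measure0//.
  apply/seteqP; split => w //=; rewrite set0_sum => /Bt.
  by rewrite /= in_itv/= ltxx.
rewrite sum_by_card big_ltn// {1}/phi eqxx mule0 add0e.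
apply: eq_big_nat => k /andP[k0 _]; rewrite /phi gtn_eqF//.
have [mh h0 _] := off1_sum_density k0.
rewrite integral_coef//; first by apply: eq_integral => s _; rewrite mulrA.
  by rewrite mulrA.
by move=> s; rewrite lee_fin.
Qed.

(** * Probability of zero occupation time *)

Let integral_point (h : R -> \bar R) (a : R) : measurable_fun setT h ->
  (\int[mu]_(s in [set a]) h s = 0)%E.
Proof.
move=> mh; rewrite null_set_integral//; first exact: measurable_funTS.
exact: lebesgue_measure_set1.
Qed.

Let rest_indep n l A : sigma_seq xi A -> forall C : set R, measurable C ->
  P (rest n l @^-1` C `&` A) = (P (rest n l @^-1` C) * P A)%E.
Proof.
(* The empty list for [S], with the whole line as its event, leaves only the factor of
   [rest n l]. *)
move=> xiA C mC; have := rest_time_indep indep n l [::] xiA measurableT mC.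
by rewrite preimage_setT setTI (@probability_setT _ _ _ P) mul1e.
Qed.

Lemma P_zero_state0 : P (ev [set 0] 0) =
  (\sum_(0 <= n <oo) ((G n n t - G n.+1 n t) * p2 ^+ n)%R%:E)%E.
Proof.
rewrite P_on_event//; apply: eq_eseriesr => n _.
(* For a non-empty configuration the off-1 time has a density, hence no mass at the point 0; only
   the empty one remains. *)
rewrite (bigD1 (finset.set0 : {set 'I_n}))//= big1 ?adde0 => [|e e0]; last first.
  rewrite P_on_config// integral_point ?mul0e//.
  have [mh _ _] := off1_time_density e0; apply: emeasurable_funM => //.
  by apply/measurable_EFinP; exact: measurable_funB.
rewrite on_event_config (_ : _ `&` _ `&` _ = [set w | rest n (lseq (finset.set0 : {set 'I_n})) w <= t <
    rest n.+1 (lseq (finset.set0 : {set 'I_n})) w] `&`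
    [set w | cfg n w = (finset.set0 : {set 'I_n})]); last first.
  apply/seteqP; split => w /=; rewrite set0_sum !add0r; first by move=> [[]].
  by move=> [].
rewrite (P_crossing t _ _ _ (rest_cdf_config n _) (rest_cdf_config n.+1 _)).
- by rewrite P_config cards0 expr0 mul1r subn0 -EFinM.
- exact: measurable_config.
- exact: rest_indep (sigma_config _).
- exact: rest_indep (sigma_config _).
- exact: rest_time_le.
Qed.

Lemma P_zero_state2 : P (ev [set 0] 2) =
  (\sum_(0 <= n <oo) ((G n.+1 n t - G n.+1 n.+1 t) * p2 ^+ n.+1)%R%:E)%E.
Proof.
rewrite P_off2_event//; apply: eq_eseriesr => n _.
rewrite (bigD1 (finset.set0 : {set 'I_n}))//= big1 ?adde0 => [|e e0]; last first.
  rewrite P_off2_config// integral_point ?mul0e//.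
  have [mh _ _] := off1_time_density e0; apply: emeasurable_funM => //.
  by apply/measurable_EFinP; exact: measurable_funB.
rewrite off2_event_config (_ : _ `&` _ `&` _ = [set w | rest n.+1 (lseq (finset.set0 : {set 'I_n})) w
    <= t < rest n.+1 (n :: lseq (finset.set0 : {set 'I_n})) w] `&`
    [set w | cfg n w = (finset.set0 : {set 'I_n}) /\ xi n w <> 1]); last first.
  apply/seteqP; split => w /=; rewrite set0_sum !add0r; first by move=> [[]].
  by move=> [].
rewrite (P_crossing t _ _ _ (rest_cdf_config n.+1 _) (rest_cdf_configS n.+1 _)).
- by rewrite P_config2 cards0 expr0 mul1r subn0 -EFinM.
- exact: sigma_seq_measurable (sigma_config2 _).
- exact: rest_indep (sigma_config2 _).
- exact: rest_indep (sigma_config2 _).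
- exact: rest_time_cons_le.
Qed.

(** Every term integrates a density over the single point 0. *)
Lemma P_zero_state1 : P (ev [set 0] 1) = 0%E.
Proof.
rewrite P_off1_event// eseries0// => n _ _; rewrite big1// => e _.
rewrite P_off1_config// integral_point ?mul0e//.
have [mh _ _] := rest_density n (iota_uniq 0 (n - #|e|)).
rewrite size_iota in mh; apply: emeasurable_funM.
  by apply: (measurableT_comp mh); exact: measurable_funB.
by apply/measurable_EFinP; apply: measurable_funB; exact: measurable_cumulativeBounded.
Qed.

End onoff_distribution.

Theorem theorem1 (d : measure_display) (T : measurableType d) (R : realType)
    (P : probability T R) (U S L xi : nat -> {RV P >-> R})
    (F_U F_S F_L : cumulativeBounded (0 : R) (1 : R)) (f_U f_S f_L : R -> R)
    (p1 p2 : R)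
    (U_ge0 : forall k w, 0 <= U k w)
    (S_ge0 : forall k w, 0 <= S k w)
    (L_ge0 : forall k w, 0 <= L k w)
    (xi_ge0 : forall k w, 0 <= xi k w)
    (U_iid : iid U) (S_iid : iid S) (L_iid : iid L) (xi_iid : iid xi)
    (indep : mutually_independent P
       (fun j : 'I_4 => sigma_seq (tnth [tuple U; S; L; xi] j)))
    (U_cdf : forall k, has_cdf (U k) F_U) (U_pdf : forall k, has_pdf (U k) f_U)
    (S_cdf : forall k, has_cdf (S k) F_S) (S_pdf : forall k, has_pdf (S k) f_S)
    (L_cdf : forall k, has_cdf (L k) F_L) (L_pdf : forall k, has_pdf (L k) f_L)
    (p1_gt0 : 0 < p1) (p2E : p2 = 1 - p1)
    (xi_1 : forall k, P [set w | xi k w = 1] = p1%:E)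
    (xi_0 : forall k, P [set w | xi k w = 0] = p2%:E)
    (t : R) (t_ge0 : 0 <= t) :
  let X := onoff_process U S L xi in
  let St := occupation_time U S L xi 1 t in
  P [set w | St w = 0 /\ X t w = 0%N] =
    (\sum_(0 <= n <oo) ((cdf_conv_pow F_U n F_L n t
                         - cdf_conv_pow F_U n.+1 F_L n t) * p2 ^+ n)%R%:E)%E /\
  P [set w | St w = 0 /\ X t w = 1%N] = 0%E /\
  P [set w | St w = 0 /\ X t w = 2%N] =
    (\sum_(0 <= n <oo) ((cdf_conv_pow F_U n.+1 F_L n t
                         - cdf_conv_pow F_U n.+1 F_L n.+1 t)
                        * p2 ^+ n.+1)%R%:E)%E /\
  is_density_on `]0, t[ (fun B => P [set w | B (St w) /\ X t w = 0%N])
    (fun s => \sum_(1 <= n <oo) \sum_(1 <= k < n.+1)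
       (('C(n, k)%:R * p1 ^+ k * p2 ^+ (n - k))%R%:E
        * pdf_convn f_S k s
        * (cdf_conv_pow F_U n F_L (n - k) (t - s)
           - cdf_conv_pow F_U n.+1 F_L (n - k) (t - s))%R%:E))%E /\
  is_density_on `]0, t[ (fun B => P [set w | B (St w) /\ X t w = 1%N])
    (fun s => \sum_(0 <= n <oo) \sum_(0 <= k < n.+1)
       (('C(n, k)%:R * p1 ^+ k.+1 * p2 ^+ (n - k))%R%:E
        * pdf_conv_pow f_U n.+1 f_L (n - k) (t - s)%R
        * (cdf_convn F_S k s - cdf_convn F_S k.+1 s)%R%:E))%E /\
  is_density_on `]0, t[ (fun B => P [set w | B (St w) /\ X t w = 2%N])
    (fun s => \sum_(1 <= n <oo) \sum_(1 <= k < n.+1)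
       (('C(n, k)%:R * p1 ^+ k * p2 ^+ (n - k).+1)%R%:E
        * pdf_convn f_S k s
        * (cdf_conv_pow F_U n.+1 F_L (n - k) (t - s)
           - cdf_conv_pow F_U n.+1 F_L (n - k).+1 (t - s))%R%:E))%E.
Proof.
case: U_iid => U_indep _; case: S_iid => S_indep _.
case: L_iid => L_indep _; case: xi_iid => xi_indep _.
move=> X St; split; first by eapply P_zero_state0; eassumption.
split; first by eapply P_zero_state1; eassumption.
split; first by eapply P_zero_state2; eassumption.
split; first by eapply is_density_on_state0; eassumption.
split; first by eapply is_density_on_state1; eassumption.
by eapply is_density_on_state2; eassumption.
Qed.
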